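(* Let $d\ge 1$ and let $A$ and $B$ be nonsingular real $d\times d$ matrices such that $|\det(AB)|\le 1$. Let $h\in L^{\infty}(\mathbb{R}^d)$ be unimodular (i.e. $|h(\mathbf{x})|=1$ for a.e. $\mathbf{x}\in\mathbb{R}^d$) and suppose that for all $\mathbf{l},\mathbf{k}\in\mathbb{Z}^d$ with $\mathbf{k}\neq\mathbf{0}$, $$h(\mathbf{x})\overline{h(\mathbf{x}-(B^T)^{-1}\mathbf{k})}=h(\mathbf{x}-A\mathbf{l})\overline{h(\mathbf{x}-A\mathbf{l}-(B^T)^{-1}\mathbf{k})}\quad\text{for a.e. }\mathbf{x}\in\mathbb{R}^d .$$ Then $h$ is a functional Gabor frame multiplier with respect to the lattices $A\mathbb{Z}^d$ and $B\mathbb{Z}^d$.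
   Context: Functions are complex valued. Given nonsingular real $d\times d$ matrices $A,B$, a function $g\in L^2(\mathbb{R}^d)$ is a Parseval (or normalized tight) Gabor frame generator with respect to the lattices $A\mathbb{Z}^d$ and $B\mathbb{Z}^d$ if $$\sum_{\mathbf{l},\mathbf{k}\in\mathbb{Z}^d}\big|\langle f, e^{2\pi i\langle B\mathbf{k},\mathbf{t}\rangle}g(\mathbf{t}-A\mathbf{l})\rangle\big|^2=\|f\|^2$$ for every $f\in L^2(\mathbb{R}^d)$. A function $h\in L^{\infty}(\mathbb{R}^d)$ is a functional Gabor frame multiplier (with respect to these lattices) if $hg$ is a Parseval Gabor frame generator whenever $g$ is a Parseval Gabor frame generator. *)

(* Defs.v *)
From HB Require Import structures.
From mathcomp Require Import all_boot all_order all_algebra.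
From mathcomp Require Import all_classical all_reals all_analysis.
From mathcomp Require Import complex.

Set Implicit Arguments.
Unset Strict Implicit.
Unset Printing Implicit Defensive.
Import Order.TTheory GRing.Theory Num.Theory numFieldNormedType.Exports.
Local Open Scope classical_set_scope.
Local Open Scope ring_scope.
Local Open Scope complex_scope.

(* Product sigma-algebra on column vectors: the smallest one making all the
   coordinate maps measurable; for T = R it is the Borel sigma-algebra of R^n,
   and it mirrors the library's sigma-algebra on n.-tuple T. *)
Section measurable_cV.
Context {d} {T : measurableType d} (n : nat).

Let coords : 'I_n -> 'cV[T]_n -> T := fun i x => x i 0.

Let cV_set0 : g_sigma_preimage coords set0.
Proof. exact: sigma_algebra0. Qed.

Let cV_setC A : g_sigma_preimage coords A -> g_sigma_preimage coords (~` A).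
Proof. exact: sigma_algebraC. Qed.

Let cV_bigcup (F : (set 'cV[T]_n)^nat) :
  (forall i, g_sigma_preimage coords (F i)) ->
  g_sigma_preimage coords (\bigcup_i (F i)).
Proof. exact: sigma_algebra_bigcup. Qed.

HB.instance Definition _ := @isMeasurable.Build (measure_tuple_display d)
  'cV[T]_n (g_sigma_preimage coords) cV_set0 cV_setC cV_bigcup.

Lemma measurable_coord_cV (i : 'I_n) :
  measurable_fun [set: 'cV[T]_n] (fun x : 'cV[T]_n => x i 0).
Proof.
move=> _ Y mY; rewrite setTI; apply: sub_sigma_algebra => /=.
rewrite -bigcup_seq/=; exists i => /=; first by rewrite mem_index_enum.
by exists Y => //; rewrite setTI.
Qed.

Lemma measurable_fun_cVP d1 (T1 : measurableType d1) (f : T1 -> 'cV[T]_n) :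
  measurable_fun [set: T1] f <->
  forall i, measurable_fun [set: T1] (fun x => f x i 0).
Proof.
split=> [mf i|mf].
  exact: (measurableT_comp (measurable_coord_cV i) mf).
have : g_sigma_preimage coords `<=`
    [set A | measurable (f @^-1` A)].
  apply: smallest_sub.
    split=> [|A mA|F mF] /=.
    - by rewrite preimage_set0.
    - by rewrite setTD preimage_setC; exact: measurableC.
    - by rewrite preimage_bigcup; apply: bigcup_measurable => k _; exact: mF.
  rewrite -bigcup_seq/= => A [i _ [B mB <-]] /=.
  by have := mf i measurableT B mB; rewrite !setTI.
by move=> mfA _ A mA; rewrite setTI; exact: mfA.
Qed.

End measurable_cV.

Section lebesgue_cV.
Context {R : realType}.

Definition cons_cV n (p : measurableTypeR R * 'cV[R]_n) : 'cV[R]_n.+1 :=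
  col_mx (p.1 : R)%:M p.2.

Lemma cons_cV0 n p : @cons_cV n p 0 0 = p.1.
Proof.
have := col_mxEu (p.1 : R)%:M p.2 0 0; rewrite [RHS]mxE eqxx mulr1n => <-.
by rewrite /cons_cV; congr (col_mx _ _ _ _); exact/val_inj.
Qed.

Lemma cons_cVS n p i : @cons_cV n p (lift ord0 i) 0 = p.2 i 0.
Proof.
rewrite -(col_mxEd (p.1 : R)%:M p.2).
by rewrite /cons_cV; congr (col_mx _ _ _ _); exact/val_inj.
Qed.

Lemma measurable_cons_cV n :
  measurable_fun [set: measurableTypeR R * 'cV[R]_n] (@cons_cV n).
Proof.
apply/measurable_fun_cVP => i; have [j|] := unliftP ord0 i; move=> ->.
  under eq_fun do rewrite cons_cVS.
  exact: (measurableT_comp (measurable_coord_cV j) measurable_snd).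
by under eq_fun do rewrite cons_cV0; exact: measurable_fst.
Qed.

HB.instance Definition _ n :=
  isMeasurableFun.Build _ _ _ _ (@cons_cV n) (@measurable_cons_cV n).

Section lebesgue_cVS.
Variables (n : nat) (m : {sigma_finite_measure set 'cV[R]_n -> \bar R}).

Definition lebesgue_cVS : set 'cV[R]_n.+1 -> \bar R :=
  pushforward (@lebesgue_measure R \x m)%E (@cons_cV n).

Let mu0 : lebesgue_cVS set0 = 0%E.
Proof. exact: measure0. Qed.

Let mu_ge0 A : (0 <= lebesgue_cVS A)%E.
Proof. exact: measure_ge0. Qed.

Let mu_sigma_additive : semi_sigma_additive lebesgue_cVS.
Proof. exact: measure_semi_sigma_additive. Qed.

HB.instance Definition _ := isMeasure.Build _ _ _ lebesgue_cVS
  mu0 mu_ge0 mu_sigma_additive.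

Let mu_sigma_finite : sigma_finite setT lebesgue_cVS.
Proof.
have /sigma_finiteP[F [TF ndF Foo]] := sigma_finiteT (@lebesgue_measure R).
have /sigma_finiteP[G [TG ndG Goo]] := sigma_finiteT m.
pose tail (x : 'cV[R]_n.+1) : 'cV[R]_n := \col_i x (lift ord0 i) 0.
have mtail : measurable_fun setT tail.
  apply/measurable_fun_cVP => i; under eq_fun do rewrite mxE.
  exact: measurable_coord_cV.
exists (fun k => [set x : 'cV[R]_n.+1 | F k (x 0 0)] `&` tail @^-1` G k).
  apply/seteqP; split=> x // _.
  have [i _ Fi] : (\bigcup_k F k) (x 0 0) by rewrite -TF.
  have [j _ Gj] : (\bigcup_k G k) (tail x) by rewrite -TG.
  exists (maxn i j) => //; split.
    by have /subsetPset := ndF _ _ (leq_maxl i j); exact.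
  by have /subsetPset := ndG _ _ (leq_maxr i j); exact.
move=> k; have [mF Fy] := Foo k; have [mG Gy] := Goo k; split.
  apply: measurableI; last by rewrite -[X in measurable X]setTI; exact: mtail.
  by rewrite -[X in measurable X]setTI; exact: measurable_coord_cV.
rewrite /lebesgue_cVS /pushforward (_ : _ @^-1` _ = F k `*` G k).
  by rewrite product_measure1E// lte_mul_pinfty// ge0_fin_numE.
apply/seteqP; split=> -[a y] /=; rewrite cons_cV0;
  rewrite (_ : tail _ = y)//; by apply/colP => i; rewrite mxE cons_cVS.
Qed.

HB.instance Definition _ := Measure_isSigmaFinite.Build _ _ _ lebesgue_cVS
  mu_sigma_finite.

End lebesgue_cVS.

(* Lebesgue measure on R^n, as an iterated product; cf. lebesgue_cV_box. *)
Fixpoint lebesgue_cV n : {sigma_finite_measure set 'cV[R]_n -> \bar R} :=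
  match n with
  | 0 => \d_(0 : 'cV[R]_0)
  | n'.+1 => lebesgue_cVS (lebesgue_cV n')
  end.

Lemma lebesgue_cV_box n (A : 'I_n -> set (measurableTypeR R)) :
  (forall i, measurable (A i)) ->
  lebesgue_cV n [set x : 'cV[R]_n | forall i, A i (x i 0)] =
  (\prod_(i < n) lebesgue_measure (A i))%E.
Proof.
elim: n A => [|n IHn] A mA.
  by rewrite big_ord0 /= diracE mem_set//= => -[].
rewrite big_ord_recl -IHn// -product_measure1E//.
  rewrite /= /lebesgue_cVS /pushforward; congr (product_measure1 _ _ _).
  apply/seteqP; split=> -[a y] /=.
    move=> Ax; split=> [|i]; first by have := Ax ord0; rewrite cons_cV0.
    by have := Ax (lift ord0 i); rewrite cons_cVS.
  move=> [Aa Ay] i; have [j|] := unliftP ord0 i; move=> ->.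
    by rewrite cons_cVS.
  by rewrite cons_cV0.
rewrite [X in measurable X](_ : _ =
    \big[setI/setT]_(i < n) ((fun x : 'cV[R]_n => x i 0) @^-1`
      A (lift ord0 i))); last first.
  rewrite -bigcap_seq; apply/seteqP; split=> x /= Ax i; first by move=> _.
  by apply: Ax; exact: mem_index_enum.
apply: bigsetI_measurable => i _.
by have := measurable_coord_cV i measurableT (mA (lift ord0 i)); rewrite setTI.
Qed.

End lebesgue_cV.

Section complex_Lebesgue.
Context {R : realType} {d : nat}.
Local Notation mu := (@lebesgue_cV R d).
Implicit Types f g : 'cV[R]_d -> R[i].

Definition cmeasurable f :=
  measurable_fun setT (fun x => complex.Re (f x)) /\
  measurable_fun setT (fun x => complex.Im (f x)).

Definition cLnorm (p : \bar R) f : \bar R :=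
  'N[mu]_p[EFin \o @Normc.normc R \o f]%E.

(* L^p is handled through Borel representatives: every class modulo null sets
   contains one, and all notions below are invariant under a.e. equality. *)
Definition cLp (p : \bar R) f := cmeasurable f /\ (cLnorm p f < +oo)%E.

Definition cintegral f : R[i] :=
  (\int[mu]_x complex.Re (f x)) +i* (\int[mu]_x complex.Im (f x)).

Definition inner f g : R[i] := cintegral (fun x => f x * (g x)^*).

End complex_Lebesgue.

Section Gabor.
Context {R : realType} {d : nat}.
Implicit Types (A B : 'M[R]_d) (l k : 'cV[int]_d).
Implicit Types f g h : 'cV[R]_d -> R[i].

Definition intcV k : 'cV[R]_d := map_mx intr k.

Definition dotcV (x y : 'cV[R]_d) : R := \sum_i x i 0 * y i 0.

Definition expi (r : R) : R[i] := cos r +i* sin r.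

Definition gabor_atom A B g l k : 'cV[R]_d -> R[i] := fun t =>
  expi (2 * pi * dotcV (B *m intcV k) t) * g (t - A *m intcV l).

Definition parseval_gabor_generator A B g :=
  cLp 2%:E g /\
  forall f, cLp 2%:E f ->
    (\esum_(lk in [set: 'cV[int]_d * 'cV[int]_d])
       (Normc.normc (inner f (gabor_atom A B g lk.1 lk.2)) ^+ 2)%:E
     = cLnorm 2%:E f ^+ 2)%E.

Definition functional_gabor_multiplier A B h :=
  cLp +oo%E h /\
  forall g, parseval_gabor_generator A B g ->
    parseval_gabor_generator A B (fun x => h x * g x).

End Gabor.

(* Main.v *)
Require Import Defs.
From HB Require Import structures.
From mathcomp Require Import all_boot all_order all_algebra.
From mathcomp Require Import all_classical all_reals all_analysis.
From mathcomp Require Import complex.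
From mathcomp Require Import measurable_realfun ring lra.
Import Order.TTheory GRing.Theory Num.Theory numFieldNormedType.Exports.
Local Open Scope classical_set_scope.
Local Open Scope ring_scope.
Local Open Scope complex_scope.
(* Reopened on top of complex_scope so that z^* always is Num.conj, as in
   [inner], and never conjc. *)
Local Open Scope ring_scope.
Set Implicit Arguments.
Unset Strict Implicit.
Unset Printing Implicit Defensive.

(** The coefficients of [f] against the atoms of [h g] translated by [A l] are
the Fourier coefficients, at the frequencies [B k], of
[w = f * (h (. - A l))^* * (g (. - A l))^*], and those of [f * h^*] against the
atoms of [g] are the Fourier coefficients of
[v = f * h^* * (g (. - A l))^*].  Almost everywhere [w = m v], where
[m = h * (h (. - A l))^*] is unimodular and, by hypothesis, periodic under the
lattice dual to [B].  Multiplication by such an [m] preserves the square sum of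
the Fourier coefficients, so the Parseval identity for [h g] and [f] is the one
for [g] and [f * h^*].

For the invariance let [S] be the square sum of the Fourier coefficients of [v].
AM-GM gives [2 Re (int v p) <= S + |p|^2] for every trigonometric polynomial
[p], where [|p|] is the L2 norm on the torus.  This inequality survives bounded
pointwise limits, hence holds for all bounded periodic Borel functions, in
particular for [m q] with [q] a trigonometric polynomial.  Choosing [q] dual to
finitely many Fourier coefficients of [m v], with square sum [T], it reads
[2 T <= S + T]. *)

(** * Translation invariance of Lebesgue measure *)

Section translation.
Context {R : realType}.

Lemma measurable_translate (c : R) : measurable_fun setT
  (fun x : measurableTypeR R => ((x : R) + c : measurableTypeR R)).
Proof. exact: measurable_funD. Qed.

(** Uniqueness of Lebesgue measure: the image measure under the translation gives the same value to
    every half-open interval. *)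
Lemma lebesgue_measure_translate (c : R) (A : set (measurableTypeR R)) :
  measurable A ->
  lebesgue_measure ((fun x => x + c) @^-1` A) = lebesgue_measure A.
Proof.
move=> mA.
have mc := measurable_translate c.
pose F : {mfun measurableTypeR R >-> measurableTypeR R} :=
  HB.pack (fun x : measurableTypeR R => ((x : R) + c : measurableTypeR R))
      (isMeasurableFun.Build _ _ _ _ _ mc).
apply/esym/(@lebesgue_measure_unique _ (pushforward lebesgue_measure F)) => //.
move=> _ [[a b] /= _ <-]; rewrite /pushforward.
have -> : F @^-1` `]a, b] = `]a - c, b - c]%classic.
  by apply/seteqP; split=> x /=; rewrite !in_itv/= ltrBlDr lerBrDr.
rewrite !lebesgue_measure_itv/= !lte_fin ltrD2r; case: ifP => // _.
by rewrite -!EFinD; congr EFin; ring.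
Qed.

Lemma measurable_translate_cV n (c : 'cV[R]_n) :
  measurable_fun setT (fun x : 'cV[R]_n => x + c).
Proof.
apply/measurable_fun_cVP => i; under eq_fun do rewrite mxE.
by apply: measurable_funD => //; exact: measurable_coord_cV.
Qed.

(** Through [cons_cV], the translation by [c] becomes the product of a translation of the head and
    one of the tail. By induction both factors preserve measure, so the image of the product measure
    agrees with it on rectangles, and uniqueness of product measures concludes. *)
Lemma lebesgue_cV_translate n (c : 'cV[R]_n) (A : set 'cV[R]_n) :
  measurable A ->
  lebesgue_cV n ((fun x => x + c) @^-1` A) = lebesgue_cV n A.
Proof.
elim: n c A => [|n IH] c A mA.
  congr (lebesgue_cV 0 _).
  by apply/seteqP; split=> x /=; rewrite !(flatmx0 (_ + _)) (flatmx0 x).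
rewrite /= /lebesgue_cVS /pushforward.
pose t := \col_i c (lift ord0 i) 0.
pose f := fun p : measurableTypeR R * 'cV[R]_n =>
  ((p.1 : R) + c 0 0 : measurableTypeR R, p.2 + t).
have mf : measurable_fun setT f.
  apply/measurable_fun_pairP; split.
    by apply: measurable_funD => //; exact: measurable_fst.
  apply: (measurableT_comp (measurable_translate_cV t)).
  exact: measurable_snd.
pose F : {mfun (measurableTypeR R * 'cV[R]_n)%type >->
    (measurableTypeR R * 'cV[R]_n)%type} :=
  HB.pack f (isMeasurableFun.Build _ _ _ _ _ mf).
have -> : @cons_cV R n @^-1` ((fun x => x + c) @^-1` A) =
    f @^-1` (@cons_cV R n @^-1` A).
  have fE p : cons_cV (f p) = cons_cV p + c.
    apply/colP => i; rewrite [RHS]mxE; have [j ->|->] := unliftP ord0 i.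
      by rewrite !cons_cVS/= !mxE.
    by rewrite !cons_cV0.
  by apply/seteqP; split=> p /=; rewrite fE.
apply/esym; apply: (@product_measure_unique _ _ _ _ _ _ _
  (pushforward (lebesgue_measure \x lebesgue_cV n)%E F)); last first.
    by rewrite -[_ @^-1` _]setTI; apply: measurable_cons_cV.
move=> B C mB mC /=; rewrite /pushforward.
rewrite (_ : f @^-1` (B `*` C) = ((fun x : R => x + c 0 0) @^-1` B) `*`
   ((fun x => x + t) @^-1` C))//.
have mBc : measurable ((fun x : R => x + c 0 0) @^-1` B).
  by rewrite -[_ @^-1` _]setTI; exact: (measurable_translate (c 0 0)).
have mCt : measurable ((fun x => x + t) @^-1` C).
  by rewrite -[_ @^-1` _]setTI; exact: (measurable_translate_cV t).
by rewrite product_measure1E// IH//; congr (_ * _)%E;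
  exact: lebesgue_measure_translate.
Qed.

Lemma ae_translate_cV n (c : 'cV[R]_n) (P : 'cV[R]_n -> Prop) :
  {ae lebesgue_cV n, forall x, P x} -> {ae lebesgue_cV n, forall x, P (x + c)}.
Proof.
move=> [N [mN N0 PN]]; exists ((fun x => x + c) @^-1` N); split.
- by rewrite -[_ @^-1` _]setTI; exact: (measurable_translate_cV c).
- by rewrite lebesgue_cV_translate.
- by move=> x /= nP; exact: PN.
Qed.

Lemma ge0_integral_translate_cV n (c : 'cV[R]_n) (f : 'cV[R]_n -> \bar R) :
  measurable_fun setT f -> (forall x, 0 <= f x)%E ->
  (\int[lebesgue_cV n]_x f (x + c)%R = \int[lebesgue_cV n]_x f x)%E.
Proof.
move=> mf f0.
rewrite -(ge0_integral_pushforward (measurable_translate_cV c) _ measurableT)//.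
apply: eq_measure_integral => [|? A mA _]; first exact:
  (measurable_translate_cV c).
exact: lebesgue_cV_translate.
Qed.

End translation.

(** * Characters and the probability measure of the torus *)

Section expi.
Context {R : realType}.
Implicit Types a b : R.

Lemma expi0 : expi (0 : R) = 1.
Proof. by rewrite /expi cos0 sin0. Qed.

Lemma expiD a b : expi (a + b) = expi a * expi b.
Proof.
rewrite /expi cosD sinD; apply/eqP; rewrite eq_complex /=.
by rewrite eqxx/= addrC [cos a * _]mulrC [sin a * _]mulrC; apply/eqP; ring.
Qed.

Lemma expiN a : expi (- a) = (expi a)^*.
Proof. by rewrite /expi cosN sinN. Qed.

Lemma expi_nat (n : nat) : expi (2 * pi * n%:R : R) = 1.
Proof.
elim: n => [|n IH]; first by rewrite mulr0 expi0.
rewrite -(natr1 n) mulrDr mulr1 expiD IH mul1r /expi mulrC mulr_natr.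
by rewrite cos2pi sin2pi.
Qed.

Lemma expi_int (k : int) : expi (2 * pi * k%:~R : R) = 1.
Proof.
case: k => n; first exact: expi_nat.
by rewrite NegzE mulrNz mulrN expiN [_%:~R]/= expi_nat rmorph1.
Qed.

Lemma expiDint a (k : int) : expi (a + 2 * pi * k%:~R) = expi a.
Proof. by rewrite expiD expi_int mulr1. Qed.

Lemma cosDint a (k : int) : cos (a + 2 * pi * k%:~R) = cos a.
Proof. by have := expiDint a k => /(congr1 (@complex.Re R)). Qed.

Lemma sinDint a (k : int) : sin (a + 2 * pi * k%:~R) = sin a.
Proof. by have := expiDint a k => /(congr1 (@complex.Im R)). Qed.

End expi.

Section dot.
Context {R : realType} {n : nat}.
Implicit Types x y : 'cV[R]_n.

Lemma dotcVC x y : dotcV x y = dotcV y x.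
Proof. by apply: eq_bigr => i _; rewrite mulrC. Qed.

Lemma dotcVDl x y z : dotcV (x + y) z = dotcV x z + dotcV y z.
Proof. by rewrite /dotcV -big_split; apply: eq_bigr => i _;
  rewrite mxE mulrDl. Qed.

Lemma dotcVNl x z : dotcV (- x) z = - dotcV x z.
Proof. by rewrite /dotcV -sumrN; apply: eq_bigr => i _; rewrite mxE mulNr. Qed.

Lemma dotcVDr x y z : dotcV z (x + y) = dotcV z x + dotcV z y.
Proof. by rewrite !(dotcVC z) dotcVDl. Qed.

Lemma dotcV_intcV (k l : 'cV[int]_n) :
  dotcV (intcV k) (intcV l) = (\sum_i k i 0 * l i 0)%:~R :> R.
Proof. by rewrite rmorph_sum; apply: eq_bigr => i _; rewrite !mxE rmorphM. Qed.

Lemma intcVD (k l : 'cV[int]_n) : intcV (k + l) = intcV k + intcV l :> 'cV[R]_n.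
Proof. exact: map_mxD. Qed.

Lemma intcVN (k : 'cV[int]_n) : intcV (- k) = - intcV k :> 'cV[R]_n.
Proof. exact: map_mxN. Qed.

Lemma dotcV_mulmx (M : 'M[R]_n) x y : dotcV (M *m x) y = dotcV x (M^T *m y).
Proof.
have dotE u v : dotcV u v = (u^T *m v) 0 0.
  by rewrite mxE; apply: eq_bigr => i _; rewrite mxE.
by rewrite !dotE trmx_mul mulmxA.
Qed.

Lemma measurable_dotcV x : measurable_fun setT (dotcV x).
Proof.
apply: measurable_sum => i; apply: measurable_funM => //.
exact: measurable_coord_cV.
Qed.

Lemma measurable_mulmx_cV (M : 'M[R]_n) :
  measurable_fun setT (fun x : 'cV[R]_n => M *m x).
Proof.
apply/measurable_fun_cVP => i; under eq_fun do rewrite mxE.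
apply: measurable_sum => j; apply: measurable_funM => //.
exact: measurable_coord_cV.
Qed.

End dot.

Section torus.
Context {R : realType}.
Local Notation U := (uniform_prob (@ltr01 R)).

(** The uniform probability on the unit cube. On functions with period lattice Z^n it plays the role
    of the normalized Haar measure of R^n / Z^n. *)
Fixpoint torus n : probability 'cV[R]_n R :=
  match n with
  | 0 => \d_(0 : 'cV[R]_0)
  | n'.+1 => distribution (U \x torus n')%E (@cons_cV R n')
  end.

Lemma measurable_cos_comp d (T : measurableType d) (f : T -> R) :
  measurable_fun setT f -> measurable_fun setT (fun x => cos (f x)).
Proof.
move=> mf; apply: (measurableT_comp _ mf).
exact: (continuous_measurable_fun (@continuous_cos R)).
Qed.

Lemma measurable_sin_comp d (T : measurableType d) (f : T -> R) :
  measurable_fun setT f -> measurable_fun setT (fun x => sin (f x)).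
Proof.
move=> mf; apply: (measurableT_comp _ mf).
exact: (continuous_measurable_fun (@continuous_sin R)).
Qed.

Lemma bounded_integrable d (T : measurableType d) (P : probability T R)
    (f : T -> R) C : measurable_fun setT f -> (forall x, `|f x| <= C) ->
  P.-integrable setT (EFin \o f).
Proof.
move=> mf fC; apply: measurable_bounded_integrable => //.
  exact: le_lt_trans (probability_le1 P measurableT) (ltry 1).
exists C; split; first by rewrite num_real.
by move=> M CM x _; apply: (le_trans (fC x)); exact: ltW.
Qed.

(** Adding 1 makes the integrand nonnegative, as [integral_uniform] asks. The primitive
    [x + sin (w * x + c) / w] then gives 1 over the unit interval, because [w] is an integer
    multiple of 2 pi. *)
Lemma integral_uniform_cos (k : int) (c : R) : k != 0 ->
  (\int[U]_x (cos (2 * pi * k%:~R * x + c))%:E = 0)%E.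
Proof.
move=> k0; pose w : R := 2 * pi * k%:~R.
have w0 : w != 0 by rewrite !mulf_neq0// ?intr_eq0// gt_eqF// ?pi_gt0.
have cf : continuous (fun x : R => 1 + cos (w * x + c)).
  move=> x; apply: cvgD; first exact: cvg_cst.
  apply: (@continuous_comp _ _ _ (fun x : R => w * x + c) cos); last first.
    exact: continuous_cos.
  by apply: cvgD; [exact: mulrl_continuous|exact: cvg_cst].
have mc : measurable_fun setT (fun x : measurableTypeR R => cos (w * x + c)).
  apply: measurable_cos_comp; apply: measurable_funD => //.
have f0 (x : R) : (0 <= (1 + cos (w * x + c))%:E)%E.
  by rewrite lee_fin -lerBlDl sub0r cos_geN1.
have : (\int[U]_x (1 + cos (w * x + c))%:E = 1)%E.
  rewrite integral_uniform//; last first.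
    by apply/measurable_EFinP; apply: measurable_funD.
  rewrite subr0 invr1 mul1e.
  pose F := fun x : R => x + sin (w * x + c) / w.
  have dF (x : R) : is_derive x 1 F (1 + cos (w * x + c)).
    apply: is_derive_eq.
    by rewrite /GRing.scale/= mulr0 add0r addr0 mulr1 mulrCA mulVf ?mulr1.
  rewrite (@continuous_FTC2 _ _ F)//.
  - rewrite /F mulr1 mulr0 add0r add0r addrC.
    rewrite [w + c]addrC (sinDint c k : sin (c + w) = sin c).
    by rewrite -EFinD; congr EFin; ring.
  - exact: continuous_subspaceT.
  - split=> [x _||]; first exact: ex_derive.
      apply: cvg_at_right_filter.
      exact/differentiable_continuous/derivable1_diffP/ex_derive.
    apply: cvg_at_left_filter.
    exact/differentiable_continuous/derivable1_diffP/ex_derive.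
  - by move=> x _; rewrite derive1E; apply: derive_val.
under eq_integral do rewrite EFinD.
rewrite integralD//=; last 2 first.
  by apply: (@bounded_integrable _ _ _ _ 1) => // x; rewrite normr1.
  by apply: (@bounded_integrable _ _ _ _ 1) => // x; exact: cos_max.
have -> : (\int[U]_x 1 = 1)%E.
  by rewrite integral_cst// mul1e; exact: probability_setT.
(* An infinite integral of the cosine would contradict the total value 1, so only a real [r] with
   [1 + r = 1] remains. *)
by rewrite -/w; case: (integral _ _ _) => [r| |]//= [r1]; congr EFin; lra.
Qed.

Lemma torus_cos n (k : 'cV[int]_n) (c : R) : k != 0 ->
  (\int[torus n]_x (cos (2 * pi * dotcV (intcV k) x + c))%:E = 0)%E.
Proof.
elim: n k c => [|n IH] k c k0; first by rewrite flatmx0 eqxx in k0.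
have mf m (l : 'cV[int]_m) a :
  measurable_fun setT (fun x => cos (2 * pi * dotcV (intcV l) x + a) : R).
  apply: measurable_cos_comp; apply: measurable_funD => //.
  by apply: measurable_funM => //; exact: measurable_dotcV.
pose k' := \col_i k (lift ord0 i) 0.
have dotE (p : measurableTypeR R * 'cV[R]_n) : dotcV (intcV k) (cons_cV p) =
    (k 0 0)%:~R * (p.1 : R) + dotcV (intcV k') p.2.
  rewrite /dotcV big_ord_recl cons_cV0 !mxE; congr (_ + _).
  by apply: eq_bigr => i _; rewrite cons_cVS !mxE.
have mcons : measurable_fun setT (fun p => cos (2 * pi * dotcV (intcV k)
    (@cons_cV R n p) + c)).
  exact: (measurableT_comp (mf n.+1 k c) (@measurable_cons_cV R n)).
have Ic : (U \x torus n)%E.-integrable setT (EFin \o (fun p => cos (2 * pi *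
    dotcV (intcV k) (@cons_cV R n p) + c))).
  by apply: (@bounded_integrable _ _ _ _ 1) => // x; exact: cos_max.
rewrite (integral_distribution _ Ic)//; last by apply/measurable_EFinP;
  exact: mf.
have [k00|k00] := eqVneq (k 0 0) 0.
  rewrite -integral12_prod_meas1//= /fubini_F.
  under eq_integral.
    move=> x _; under eq_integral do rewrite /= dotE k00 mul0r add0r.
    rewrite IH; first over.
    apply: contra_neq k0 => k'0; apply/colP => i; rewrite mxE.
    have [j ->|-> //] := unliftP ord0 i.
    by move/colP : k'0 => /(_ j); rewrite !mxE.
  by rewrite integral0.
rewrite -integral21_prod_meas1//= /fubini_G.
transitivity (\int[torus n]_y (0 : \bar R))%E; last by rewrite integral0.
apply: eq_integral => y _.
rewrite -(integral_uniform_cos (2 * pi * dotcV (intcV k') y + c) k00).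
by apply: eq_integral => x _; rewrite /= dotE; congr (cos _)%:E;
  rewrite mulrDr -addrA mulrA.
Qed.

End torus.

(** * Complex-valued integrals *)

Section complex_parts.
Context {R : realType}.
Implicit Types x y : R[i].

Lemma ReD x y : complex.Re (x + y) = complex.Re x + complex.Re y.
Proof. by case: x; case: y. Qed.

Lemma ImD x y : complex.Im (x + y) = complex.Im x + complex.Im y.
Proof. by case: x; case: y. Qed.

Lemma ReM x y : complex.Re (x * y) =
  complex.Re x * complex.Re y - complex.Im x * complex.Im y.
Proof. by case: x; case: y. Qed.

Lemma ImM x y : complex.Im (x * y) =
  complex.Re x * complex.Im y + complex.Im x * complex.Re y.
Proof. by case: x; case: y. Qed.

Lemma Re_conj x : complex.Re x^* = complex.Re x. Proof. by case: x. Qed.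

Lemma Im_conj x : complex.Im x^* = - complex.Im x. Proof. by case: x. Qed.

Definition ReImE := (ReD, ImD, ReM, ImM, Re_conj, Im_conj).

Lemma complex_eq x y : complex.Re x = complex.Re y ->
  complex.Im x = complex.Im y -> x = y.
Proof. by case: x => a b; case: y => a' b' /= -> ->. Qed.

Lemma normc_sqr x : Normc.normc x ^+ 2 = complex.Re x ^+ 2 + complex.Im x ^+ 2.
Proof. by case: x => a b /=; rewrite sqr_sqrtr// addr_ge0// sqr_ge0. Qed.

Lemma normc_ge0 x : 0 <= Normc.normc x.
Proof. by case: x => a b /=; rewrite sqrtr_ge0. Qed.

Lemma Re_mulJ x : complex.Re (x * x^*) = Normc.normc x ^+ 2.
Proof. by rewrite normc_sqr !ReImE; ring. Qed.

Lemma ler_Re_normc x : `|complex.Re x| <= Normc.normc x.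
Proof.
rewrite -[leRHS]ger0_norm ?normc_ge0// -ler_sqr ?nnegrE// !real_normK
  ?num_real//.
by rewrite normc_sqr lerDl sqr_ge0.
Qed.

Lemma ler_Im_normc x : `|complex.Im x| <= Normc.normc x.
Proof.
rewrite -[leRHS]ger0_norm ?normc_ge0// -ler_sqr ?nnegrE// !real_normK
  ?num_real//.
by rewrite normc_sqr lerDr sqr_ge0.
Qed.

Lemma normcJ x : Normc.normc x^* = Normc.normc x.
Proof. by case: x => a b /=; rewrite sqrrN. Qed.

Lemma normc_expi (a : R) : Normc.normc (expi a) = 1.
Proof. by rewrite /= cos2Dsin2 sqrtr1. Qed.

End complex_parts.

Section complex_integral.
Context {d} {T : measurableType d} {R : realType}.
Variable mu : {measure set T -> \bar R}.
Implicit Types f g : T -> R[i].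

(** Over an arbitrary measurable space, [cmeas] and [cint] below repeat [cmeasurable] and
    [cintegral], with which they are convertible on R^d, so that the torus measure and Lebesgue
    measure share one theory. *)
Definition cmeas f :=
  measurable_fun setT (fun x => complex.Re (f x)) /\
  measurable_fun setT (fun x => complex.Im (f x)).

Lemma cmeasD f g : cmeas f -> cmeas g -> cmeas (fun x => f x + g x).
Proof.
move=> [fR fI] [gR gI]; split; under eq_fun do rewrite ReImE.
  exact: measurable_funD.
exact: measurable_funD.
Qed.

Lemma cmeasM f g : cmeas f -> cmeas g -> cmeas (fun x => f x * g x).
Proof.
move=> [fR fI] [gR gI]; split; under eq_fun do rewrite ReImE.
  by apply: measurable_funB; apply: measurable_funM.
by apply: measurable_funD; apply: measurable_funM.
Qed.

Lemma cmeasJ f : cmeas f -> cmeas (fun x => (f x)^*).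
Proof.
move=> [fR fI]; split; under eq_fun do rewrite ReImE; first exact: fR.
exact: (measurable_funN fI).
Qed.

Lemma cmeas_cst (c : R[i]) : cmeas (fun=> c).
Proof. by split; exact: measurable_cst. Qed.

Lemma cmeas_comp d' (T' : measurableType d') (phi : T' -> T) f :
  measurable_fun setT phi -> cmeas f ->
  measurable_fun setT (fun x => complex.Re (f (phi x))) /\
  measurable_fun setT (fun x => complex.Im (f (phi x))).
Proof.
move=> mphi [fR fI]; split.
  exact: (measurableT_comp fR mphi).
exact: (measurableT_comp fI mphi).
Qed.

Lemma measurable_normc f : cmeas f ->
  measurable_fun setT (fun x => Normc.normc (f x)).
Proof.
move=> [fR fI].
have -> : (fun x => Normc.normc (f x)) = fun x =>
    Num.sqrt (complex.Re (f x) ^+ 2 + complex.Im (f x) ^+ 2).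
  by apply/funext => x; case: (f x).
apply: (measurableT_comp (continuous_measurable_fun (@sqrt_continuous R))).
by apply: measurable_funD; apply: measurable_funX.
Qed.

Definition cint f : R[i] :=
  (\int[mu]_x complex.Re (f x)) +i* (\int[mu]_x complex.Im (f x)).

Definition cintegrable f :=
  mu.-integrable setT (EFin \o (fun x => complex.Re (f x))) /\
  mu.-integrable setT (EFin \o (fun x => complex.Im (f x))).

Lemma cintegrable0 : cintegrable (fun=> 0).
Proof. by split; exact: integrable0. Qed.

Lemma cintegrableD f g : cintegrable f -> cintegrable g ->
  cintegrable (fun x => f x + g x).
Proof.
move=> [fR fI] [gR gI]; split.
  apply: eq_integrable (integrableD measurableT fR gR) => //.
  by move=> x _ /=; rewrite ReImE.
apply: eq_integrable (integrableD measurableT fI gI) => //.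
by move=> x _ /=; rewrite ReImE.
Qed.

Lemma cintD f g : cintegrable f -> cintegrable g ->
  cint (fun x => f x + g x) = cint f + cint g.
Proof.
move=> [fR fI] [gR gI]; apply: complex_eq; rewrite ?ReImE /cint/=.
  by rewrite -RintegralD//; apply: eq_Rintegral => x _; rewrite ReImE.
by rewrite -RintegralD//; apply: eq_Rintegral => x _; rewrite ReImE.
Qed.

Lemma integrableZl_EFin (c : R) (f : T -> R) :
  mu.-integrable setT (EFin \o f) ->
  mu.-integrable setT (EFin \o (fun x => c * f x)).
Proof. by move=> fi; exact: (integrableZl measurableT c fi). Qed.

Lemma cintegrableZ c f : cintegrable f -> cintegrable (fun x => c * f x).
Proof.
move=> [fR fI]; split.
  apply: eq_integrable (integrableB measurableT
    (integrableZl_EFin (complex.Re c) fR) (integrableZl_EFin (complex.Im c)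
      fI)) => //.
  by move=> x _ /=; rewrite ReImE.
apply: eq_integrable (integrableD measurableT
  (integrableZl_EFin (complex.Re c) fI) (integrableZl_EFin (complex.Im c) fR))
    => //.
by move=> x _ /=; rewrite ReImE.
Qed.

Lemma cintZ c f : cintegrable f -> cint (fun x => c * f x) = c * cint f.
Proof.
move=> [fR fI]; apply: complex_eq; rewrite ?ReImE /cint/=.
  rewrite -!RintegralZl// -RintegralB//; try exact: integrableZl_EFin.
  by apply: eq_Rintegral => x _; rewrite ReImE.
rewrite -!RintegralZl// -RintegralD//; try exact: integrableZl_EFin.
by apply: eq_Rintegral => x _; rewrite ReImE.
Qed.

Lemma eq_cint f g : f =1 g -> cint f = cint g.
Proof. by move=> fg; congr cint; exact/funext. Qed.

(** Both conclusions go through one induction, since additivity of the integral at each step uses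
    the integrability of the remaining sum. *)
Lemma cint_sum (I : Type) (s : seq I) (c : I -> R[i]) (f : I -> T -> R[i]) :
  (forall i, cintegrable (f i)) ->
  cintegrable (fun x => \sum_(i <- s) c i * f i x) /\
  cint (fun x => \sum_(i <- s) c i * f i x) = \sum_(i <- s) c i * cint (f i).
Proof.
move=> fi; elim: s => [|a s [IHi IHe]].
  under eq_fun do rewrite big_nil; split; first exact: cintegrable0.
  by rewrite big_nil /cint /= /Rintegral integral0.
under eq_fun do rewrite big_cons; rewrite big_cons -IHe -cintZ//.
by split; [apply: cintegrableD|apply: cintD] => //; exact: cintegrableZ.
Qed.

Lemma cintegrable_le f (g : T -> R) : cmeas f -> mu.-integrable setT (EFin \o
  g) ->
  (forall x, Normc.normc (f x) <= g x) -> cintegrable f.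
Proof.
move=> [fR fI] gi fg; split; apply: (le_integrable measurableT _ _ gi).
- exact/measurable_EFinP.
- move=> x _ /=; rewrite lee_fin (le_trans (ler_Re_normc _))//.
  by rewrite (le_trans (fg x))// ler_norm.
- exact/measurable_EFinP.
- move=> x _ /=; rewrite lee_fin (le_trans (ler_Im_normc _))//.
  by rewrite (le_trans (fg x))// ler_norm.
Qed.

Lemma cint_ae_eq f g : cmeas f -> cmeas g -> {ae mu, forall x, f x = g x} ->
  cint f = cint g.
Proof.
move=> [fR fI] [gR gI] fg; rewrite /cint /Rintegral.
congr (fine _ +i* fine _); apply: ae_eq_integral => //;
  try exact/measurable_EFinP; apply: filterS fg => x /= -> //.
Qed.

Lemma normc_integrable f : cintegrable f ->
  mu.-integrable setT (EFin \o (fun x => Normc.normc (f x))).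
Proof.
move=> [fR fI].
have mf : cmeas f.
  by split; apply/measurable_EFinP; apply: measurable_int; eassumption.
apply: (le_integrable measurableT _ _
  (integrableD measurableT (integrable_norm fR) (integrable_norm fI))).
  exact/measurable_EFinP/measurable_normc.
move=> x _ /=; rewrite lee_fin ger0_norm ?normc_ge0// ger0_norm ?addr_ge0//.
rewrite -ler_sqr ?nnegrE ?normc_ge0 ?addr_ge0// normc_sqr sqrrD.
by rewrite !real_normK ?num_real// lerD2r lerDl mulrn_wge0// mulr_ge0.
Qed.

End complex_integral.

(** * Trigonometric polynomials *)

Section trigonometric.
Context {R : realType} {n : nat}.
Implicit Types (k l : 'cV[int]_n) (p q : 'cV[R]_n -> R[i]).

Definition chi k (x : 'cV[R]_n) : R[i] := expi (2 * pi * dotcV (intcV k) x).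

Lemma chi0 x : chi 0 x = 1.
Proof.
by rewrite /chi /dotcV big1 ?mulr0 ?expi0// => i _; rewrite !mxE mul0r.
Qed.

Lemma chiD k l x : chi (k + l) x = chi k x * chi l x.
Proof. by rewrite /chi intcVD dotcVDl mulrDr expiD. Qed.

Lemma chiN k x : chi (- k) x = (chi k x)^*.
Proof. by rewrite /chi intcVN dotcVNl mulrN expiN. Qed.

Lemma chi_period k l x : chi k (x + intcV l) = chi k x.
Proof. by rewrite /chi dotcVDr mulrDr dotcV_intcV expiDint. Qed.

Lemma normc_chi k x : Normc.normc (chi k x) = 1.
Proof. exact: normc_expi. Qed.

Lemma cmeas_chi k : cmeas (chi k).
Proof.
have mf : measurable_fun setT (fun x : 'cV[R]_n => 2 * pi * dotcV (intcV k) x).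
  by apply: measurable_funM => //; exact: measurable_dotcV.
split; first exact: measurable_cos_comp.
exact: measurable_sin_comp.
Qed.

Lemma cint_torus_chi k : k != 0 -> cint (torus n) (chi k) = 0.
Proof.
move=> k0; apply: complex_eq; rewrite /cint/= /Rintegral.
  rewrite -[RHS](congr1 fine (torus_cos 0 k0)); congr fine.
  by apply: eq_integral => x _; rewrite addr0.
rewrite -[RHS](congr1 fine (torus_cos (- (pi / 2)) k0)); congr fine.
by apply: eq_integral => x _; rewrite cosBpihalf.
Qed.

(* With conjugated characters, integrating [p] against [f] yields a combination
   of the Fourier coefficients of [f] itself. *)
Definition trig p := exists (s : seq 'cV[int]_n) (c : 'cV[int]_n -> R[i]),
  uniq s /\ forall x, p x = \sum_(k <- s) c k * (chi k x)^*.

(** Padding coefficients by zero lets two trigonometric polynomials be written over a common list of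
    frequencies. *)
Lemma sum_supset (s t : seq 'cV[int]_n) (F : 'cV[int]_n -> R[i]) :
  uniq s -> uniq t -> {subset s <= t} ->
  \sum_(k <- t) (if k \in s then F k else 0) = \sum_(k <- s) F k.
Proof.
move=> us ut st; rewrite -big_mkcond -big_filter; apply: perm_big.
apply: uniq_perm => //; first exact: filter_uniq.
move=> k; rewrite mem_filter; apply: andb_idr; exact: st.
Qed.

Lemma trigD p q : trig p -> trig q -> trig (fun x => p x + q x).
Proof.
move=> [s [c [us pE]]] [t [e [ut qE]]].
exists (undup (s ++ t)), (fun k => (if k \in s then c k else 0) +
  (if k \in t then e k else 0)); split; first exact: undup_uniq.
move=> x; under eq_bigr do rewrite mulrDl !(fun_if ( *%R^~ _)) !mul0r.
rewrite big_split/= !sum_supset ?undup_uniq// ?pE ?qE// => k kt;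
  by rewrite mem_undup mem_cat kt ?orbT.
Qed.

Lemma trig0 : trig (fun=> 0).
Proof. by exists [::], (fun=> 0); split=> // x; rewrite big_nil. Qed.

Lemma trigMchi c k p : trig p -> trig (fun x => c * (chi k x)^* * p x).
Proof.
move=> [s [e [us pE]]]; exists [seq k + l | l <- s], (fun l => c * e (l - k)).
split; first by rewrite map_inj_uniq//; exact: addrI.
move=> x; rewrite big_map pE big_distrr/=; apply: eq_bigr => l _.
by rewrite addrAC subrr add0r chiD rmorphM/=; ring.
Qed.

Lemma trigM p q : trig p -> trig q -> trig (fun x => p x * q x).
Proof.
move=> [s [c [_ pE]]] tq.
have -> : (fun x => p x * q x) = fun x => \sum_(k <- s)
  (c k * (chi k x)^* * q x).
  by apply/funext => x; rewrite pE big_distrl.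
elim: s {pE} => [|k s IH]; first by under eq_fun do rewrite big_nil;
  exact: trig0.
by under eq_fun do rewrite big_cons; apply: trigD => //; exact: trigMchi.
Qed.

Lemma trig_chi c k : trig (fun x => c * (chi k x)^*).
Proof. by exists [:: k], (fun=> c); split=> // x; rewrite big_seq1. Qed.

Lemma trig_cst c : trig (fun=> c).
Proof.
have := trig_chi c 0.
by under eq_fun do rewrite chi0 rmorph1 mulr1.
Qed.

Lemma trigJ p : trig p -> trig (fun x => (p x)^*).
Proof.
move=> [s [c [us pE]]]; exists [seq - k | k <- s], (fun k => (c (- k))^*).
split; first by rewrite map_inj_uniq//; exact: oppr_inj.
move=> x; rewrite big_map pE rmorph_sum; apply: eq_bigr => k _.
by rewrite opprK rmorphM/= chiN.
Qed.

Lemma trig_Re p : trig p -> trig (fun x => (complex.Re (p x))%:C).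
Proof.
move=> tp; have := trigM (trig_cst 2^-1) (trigD tp (trigJ tp)).
congr trig; apply/funext => x.
by rewrite [_^*](_ : _ = (p x)^*%C)// addcJ mulrA mulVf ?mul1r// pnatr_eq0.
Qed.

Lemma trig_Im p : trig p -> trig (fun x => (complex.Im (p x))%:C).
Proof.
move=> tp; have := trig_Re (trigM (trig_cst (- 'i%C)) tp).
congr trig; apply/funext => x; congr (_%:C); rewrite ReImE /=; ring.
Qed.

Lemma trig_cmeas p : trig p -> cmeas p.
Proof.
move=> [s [c [_ pE]]]; have -> : p = fun x => \sum_(k <- s) c k * (chi k x)^*.
  exact/funext.
elim: s {pE} => [|k s IH].
  by under eq_fun do rewrite big_nil; exact: cmeas_cst.
under eq_fun do rewrite big_cons; apply: cmeasD => //; apply: cmeasM.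
  exact: cmeas_cst.
by apply: cmeasJ; exact: cmeas_chi.
Qed.

Lemma trig_bounded p : trig p -> exists C, forall x, Normc.normc (p x) <= C.
Proof.
move=> [s [c [_ pE]]]; exists (\sum_(k <- s) Normc.normc (c k)) => x;
  rewrite pE.
elim: s {pE} => [|k s IH]; first by rewrite !big_nil Normc.normc0.
rewrite !big_cons (le_trans (le_normcD _ _))// lerD//.
by rewrite Normc.normcM normcJ normc_chi mulr1.
Qed.

Lemma cmeas_bounded_integrable p C : cmeas p ->
  (forall x, Normc.normc (p x) <= C) -> cintegrable (torus n) p.
Proof.
move=> mp pC; apply: (cintegrable_le (g := fun=> C)) => //.
by apply: (@bounded_integrable _ _ _ _ _ `|C|).
Qed.

Lemma cint_torus_chiE k : cint (torus n) (chi k) = (k == 0)%:R.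
Proof.
have [->|k0] := eqVneq k 0; last exact: cint_torus_chi.
rewrite (eq_cint _ chi0); apply: complex_eq; rewrite /cint/= /Rintegral.
  by rewrite integral_cst//= mul1e [X in fine X](@probability_setT _ _ R).
by rewrite integral0.
Qed.

(** Expanding [p x * (p x)^*] gives a double sum of characters [chi (l - k)]; integration kills all
    of them but the diagonal ones. *)
Lemma parseval_trig (s : seq 'cV[int]_n) (c : 'cV[int]_n -> R[i]) : uniq s ->
  \int[torus n]_x (Normc.normc (\sum_(k <- s) c k * (chi k x)^*) ^+ 2) =
  \sum_(k <- s) Normc.normc (c k) ^+ 2.
Proof.
move=> us; pose p x := \sum_(k <- s) c k * (chi k x)^*.
pose G x := \sum_(k <- s) \sum_(l <- s) c k * (c l)^* * chi (l - k) x.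
have pG x : p x * (p x)^* = G x.
  rewrite /p rmorph_sum big_distrl/=; apply: eq_bigr => k _.
  rewrite big_distrr/=; apply: eq_bigr => l _.
  by rewrite chiD chiN [X in _ * X]rmorphM/= conjCK; ring.
have ichi k : cintegrable (torus n) (chi k).
  by apply: (@cmeas_bounded_integrable _ 1 (cmeas_chi k)) => x;
    rewrite normc_chi.
transitivity (complex.Re (cint (torus n) G)).
  by rewrite /cint/=; apply: eq_Rintegral => x _; rewrite -Re_mulJ -pG.
pose H k x := \sum_(l <- s) (c k * (c l)^*) * chi (l - k) x.
have iH k : cintegrable (torus n) (H k) /\ cint (torus n) (H k) =
    \sum_(l <- s) (c k * (c l)^*) * cint (torus n) (chi (l - k)).
  by apply: (cint_sum s (fun l => c k * (c l)^*)) => l; exact: ichi.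
have -> : cint (torus n) G = \sum_(k <- s) cint (torus n) (H k).
  have [_] := cint_sum s (fun=> 1) (fun k => (iH k).1).
  under eq_bigr do rewrite mul1r; move=> <-.
  by apply: eq_cint => x; apply: eq_bigr => k _; rewrite mul1r.
rewrite raddf_sum !big_seq; apply: eq_bigr => k ks.
rewrite -[LHS]/(complex.Re (cint (torus n) (H k))) (iH k).2.
rewrite (bigD1_seq k)//= cint_torus_chiE subrr eqxx mulr1.
rewrite big1 ?addr0 ?Re_mulJ// => l lk.
by rewrite cint_torus_chiE subr_eq0 (negbTE lk) mulr0.
Qed.

End trigonometric.

(** * Bounded pointwise limits of trigonometric polynomials *)

Section bounded_closure.
Context {R : realType} {n : nat}.
Implicit Types u w : 'cV[R]_n -> R.

(** Dominated convergence, with dominating function a multiple of the modulus of [g]. *)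
Lemma cvg_Rintegral_bounded d (T : measurableType d)
    (mu : {measure set T -> \bar R}) (g : T -> R) (f_ : nat -> T -> R)
    (f : T -> R) (C : R) :
  mu.-integrable setT (EFin \o g) ->
  (forall m, measurable_fun setT (f_ m)) ->
  (forall m x, `|f_ m x| <= C) -> (forall x, f_ ^~ x @ \oo --> f x) ->
  (fun m => \int[mu]_x (g x * f_ m x)) @ \oo --> \int[mu]_x (g x * f x).
Proof.
move=> gi mf fC cf.
have mg : measurable_fun setT g by apply/measurable_EFinP;
  exact: measurable_int gi.
have mlim : measurable_fun setT f.
  exact: (measurable_fun_cvg _ (fun x _ => cf x)).
have iC : mu.-integrable setT (EFin \o (fun x => `|C| * `|g x|)).
  exact: (integrableZl_EFin `|C| (integrable_norm gi)).
have [|||||ifg _ cv] := @dominated_convergence _ _ _ mu setT measurableT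
  (fun m x => (g x * f_ m x)%:E) (fun x => (g x * f x)%:E)
  (fun x => (`|C| * `|g x|)%:E).
- by move=> m; apply/measurable_EFinP; exact: measurable_funM.
- by apply/measurable_EFinP; exact: measurable_funM.
- by apply: aeW => x _; apply: cvg_EFin; [exact: nearW|];
    apply: cvgM; [exact: cvg_cst|exact: cf].
- exact: iC.
- apply: aeW => x m _ /=; rewrite lee_fin normrM mulrC ler_wpM2r//.
  by rewrite (le_trans (fC m x))// ler_norm.
by apply: fine_cvg; rewrite fineK//; exact: integrable_fin_num.
Qed.

(** The smallest class containing the real trigonometric polynomials and closed under uniformly
    bounded pointwise limits of sequences. Being inductive, it allows limits of limits, and an
    inequality stable under such limits extends to it by induction. The values are real so that
    signs and level sets can be formed. *)
Inductive trigcl : ('cV[R]_n -> R) -> Prop :=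
| trigcl_trig u : trig (fun x => (u x)%:C) -> trigcl u
| trigcl_lim (u_ : nat -> 'cV[R]_n -> R) u (C : R) : (forall m, trigcl (u_ m))
  ->
    (forall m x, `|u_ m x| <= C) -> (forall x, u_ ^~ x @ \oo --> u x) ->
      trigcl u.

Lemma trigcl_cst (c : R) : trigcl (fun=> c).
Proof. by apply: trigcl_trig; exact: trig_cst. Qed.

Lemma trigcl_measurable u : trigcl u -> measurable_fun setT u.
Proof.
elim=> [v /trig_cmeas[]//|u_ v C _ mu_ _ cv].
exact: (measurable_fun_cvg _ (fun x _ => cv x)).
Qed.

Lemma trigcl_bounded u : trigcl u -> exists C, forall x, `|u x| <= C.
Proof.
case=> [v /trig_bounded[C vC]|u_ v C _ uC cv]; exists C => x.
  exact: le_trans (ler_Re_normc _) (vC x).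
have cn : (fun m => `|u_ m x|) @ \oo --> `|v x| by apply: cvg_norm; exact: cv.
rewrite -(cvg_lim _ cn)//.
apply: limr_le; last exact: nearW.
by apply/cvg_ex; exists `|v x|.
Qed.

(** A nested induction: first on [u], then, once [u] is a polynomial, on [w]. In each limit case the
    other function is fixed and bounded, so the limit is again a bounded one. *)
Lemma trigclD u w : trigcl u -> trigcl w -> trigcl (fun x => u x + w x).
Proof.
move=> cu cw; elim: cu => {u} [u tu|u_ u C cu IH uC ucv].
  elim: cw => {w} [w tw|w_ w C cw IH wC wcv].
    by apply: trigcl_trig; under eq_fun do rewrite rmorphD/=; exact: trigD.
  have [D uD] := trigcl_bounded (trigcl_trig tu).
  apply: (trigcl_lim (C := D + C) IH) => [m x|x].
    by rewrite (le_trans (ler_normD _ _))// lerD.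
  by apply: cvgD => //; exact: cvg_cst.
have [D wD] := trigcl_bounded cw.
apply: (trigcl_lim (C := C + D) IH) => [m x|x].
  by rewrite (le_trans (ler_normD _ _))// lerD.
by apply: cvgD => //; exact: cvg_cst.
Qed.

Lemma trigclM u w : trigcl u -> trigcl w -> trigcl (fun x => u x * w x).
Proof.
move=> cu cw; elim: cu => {u} [u tu|u_ u C cu IH uC ucv].
  elim: cw => {w} [w tw|w_ w C cw IH wC wcv].
    by apply: trigcl_trig; under eq_fun do rewrite rmorphM/=; exact: trigM.
  have [D uD] := trigcl_bounded (trigcl_trig tu).
  apply: (trigcl_lim (C := D * C) IH) => [m x|x].
    by rewrite normrM ler_pM.
  by apply: cvgM => //; exact: cvg_cst.
have [D wD] := trigcl_bounded cw.
apply: (trigcl_lim (C := C * D) IH) => [m x|x].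
  by rewrite normrM ler_pM.
by apply: cvgM => //; exact: cvg_cst.
Qed.

Lemma trigclZ (c : R) u : trigcl u -> trigcl (fun x => c * u x).
Proof. by move=> cu; apply: trigclM => //; exact: trigcl_cst. Qed.

Lemma trigcl_sum (I : Type) (s : seq I) (u_ : I -> 'cV[R]_n -> R) :
  (forall i, trigcl (u_ i)) -> trigcl (fun x => \sum_(i <- s) u_ i x).
Proof.
move=> cu; elim: s => [|i s IH].
  by under eq_fun do rewrite big_nil; exact: trigcl_cst.
by under eq_fun do rewrite big_cons; exact: trigclD.
Qed.

(* The odd cubic fixing -1, 0 and 1, whose iterates converge to the sign on
   [-1, 1]. *)
Definition sgstep (t : R) := (3 * t - t ^+ 3) / 2.

Lemma sgstepN t : sgstep (- t) = - sgstep t.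
Proof. by rewrite /sgstep; lra. Qed.

Lemma iter_sgstepN m t : iter m sgstep (- t) = - iter m sgstep t.
Proof. by elim: m => //= m ->; rewrite sgstepN. Qed.

(** One step multiplies the distance [1 - r] to the fixed point by [1 - (r + r ^+ 2) / 2]. The
    iterates stay above [t], so this factor is at most [1 - t / 2] and the convergence is
    geometric. *)
Lemma iter_sgstep_pos m (t : R) : 0 < t <= 1 ->
  t <= iter m sgstep t /\ 0 <= 1 - iter m sgstep t <= (1 - t / 2) ^+ m.
Proof.
move=> /andP[t0 t1]; elim: m => [|m [tr /andP[r0 rm]]] /=.
  by rewrite expr0 subr_ge0 t1 lexx; split=> //; lra.
move: (iter m sgstep t) tr r0 rm => r tr r0 rm.
have E : 1 - sgstep r = (1 - r) * (1 - (r + r ^+ 2) / 2) by rewrite /sgstep;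
  lra.
have h1 : r + r ^+ 2 <= 2 by nra.
have h2 : t / 2 <= (r + r ^+ 2) / 2 by nra.
split; first by rewrite /sgstep; nra.
rewrite E mulr_ge0//=; last lra.
by rewrite [leRHS]exprSr ler_pM//; lra.
Qed.

Lemma cvg_iter_sgstep (t : R) : `|t| <= 1 ->
  (fun m => iter m sgstep t) @ \oo --> Num.sg t.
Proof.
have pos (r : R) : 0 < r <= 1 -> (fun m => iter m sgstep r) @ \oo --> (1 : R).
  move=> r01; have [r0 r1] := andP r01.
  have -> : (fun m => iter m sgstep r) = (fun m => 1 - (1 - iter m sgstep r)).
    by apply/funext => m; rewrite opprB addrC subrK.
  rewrite -[X in _ --> X]subr0; apply: cvgB; first exact: cvg_cst.
  apply: (@squeeze_cvgr _ _ _ _ (fun=> 0) (fun m => (1 - r / 2) ^+ m)).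
  - by apply: nearW => m; have [] := iter_sgstep_pos m r01.
  - exact: cvg_cst.
  - by apply: cvg_expr; rewrite ger0_norm; lra.
have [t0|t0|->] := ltgtP t 0; rewrite ler_norml => /andP[t1 t1'].
- rewrite ltr0_sg// -[t]opprK.
  under eq_fun do rewrite iter_sgstepN.
  by apply: cvgN; apply: pos; lra.
- by rewrite gtr0_sg//; apply: pos; rewrite t0.
- rewrite sgr0; under eq_fun => m.
    rewrite (_ : iter m sgstep 0 = 0); first over.
    by elim: m => //= m ->; rewrite /sgstep; lra.
  exact: cvg_cst.
Qed.

(** Rescale [u] into [-1, 1] and iterate [sgstep], which is polynomial: the bounded limit is the
    sign [s] of [u], and [(s + s ^+ 2) / 2] is the indicator of positivity. *)
Lemma trigcl_gt0 u : trigcl u -> trigcl (fun x => (0 < u x)%R%:R).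
Proof.
move=> cu; have [C uC] := trigcl_bounded cu; pose D := `|C| + 1.
have D0 : 0 < D by rewrite ltr_wpDl.
pose w x := D^-1 * u x; have cw : trigcl w by exact: trigclZ.
have w1 x : `|w x| <= 1.
  rewrite normrM gtr0_norm ?invr_gt0// mulrC ler_pdivrMr// mul1r.
  by rewrite (le_trans (uC x))// (le_trans (ler_norm _))// lerDl.
have step v : trigcl v -> trigcl (fun x => sgstep (v x)).
  move=> cv; have := trigclZ 2^-1 (trigclD (trigclZ 3 cv)
    (trigclZ (-1) (trigclM cv (trigclM cv cv)))).
  by congr trigcl; apply/funext => x; rewrite /sgstep; lra.
have citer m : trigcl (fun x => iter m sgstep (w x)) by elim: m => //= m;
  exact: step.
have csg : trigcl (fun x => Num.sg (w x)).
  apply: (@trigcl_lim (fun m x => iter m sgstep (w x)) _ 1 citer) => [m x|x];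
    last first.
    exact: cvg_iter_sgstep.
  elim: m => //= m; move: (iter m sgstep (w x)) => r.
  rewrite !ler_norml /sgstep => /andP[? ?].
  (* This product and the next one are [2 * (1 - sgstep r)] and [2 * (1 + sgstep r)], whence [-1, 1]
     is stable under [sgstep]. *)
  have : 0 <= (1 - r) ^+ 2 * (2 + r) by rewrite mulr_ge0 ?sqr_ge0//; lra.
  have : 0 <= (1 + r) ^+ 2 * (2 - r) by rewrite mulr_ge0 ?sqr_ge0//; lra.
  by move=> ? ?; apply/andP; split; lra.
have := trigclZ 2^-1 (trigclD csg (trigclM csg csg)).
congr trigcl; apply/funext => x; rewrite sgrM gtr0_sg ?invr_gt0// mul1r.
by have [u0|u0|u0] := ltgtP (u x) 0;
  rewrite ?(ltr0_sg u0) ?(gtr0_sg u0) ?u0 ?sgr0/=; lra.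
Qed.

End bounded_closure.

(** * Borel functions of the fractional part *)

Section fractional_part.
Context {R : realType} {n : nat}.

Lemma trigcl_prod (I : Type) (s : seq I) (u_ : I -> 'cV[R]_n -> R) :
  (forall i, trigcl (u_ i)) -> trigcl (fun x => \prod_(i <- s) u_ i x).
Proof.
move=> cu; elim: s => [|i s IH].
  by under eq_fun do rewrite big_nil; exact: trigcl_cst.
by under eq_fun do rewrite big_cons; exact: trigclM.
Qed.

Lemma trigclB (u w : 'cV[R]_n -> R) :
  trigcl u -> trigcl w -> trigcl (fun x => u x - w x).
Proof.
move=> cu cw; have := trigclD cu (trigclZ (-1) cw).
by congr trigcl; apply/funext => x; rewrite mulN1r.
Qed.

(** Reduces membership of indicators to generating sets. Complements use [1 - \1_S]; for a countable
    union, the indicators [v N] of the finite unions are bounded by 1 and eventually constant at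
    each point. *)
Lemma sigma_algebra_trigcl (T : Type) (phi : 'cV[R]_n -> T) :
  sigma_algebra setT [set S | trigcl (fun x => \1_S (phi x))].
Proof.
split=> [|S cS|F cF] /=.
- by under eq_fun do rewrite indicE in_set0; exact: trigcl_cst.
- have := trigclB (trigcl_cst 1) cS; congr trigcl; apply/funext => x.
  rewrite setTD !indicE in_setC; by case: (_ \in _); rewrite /= ?subrr ?subr0.
pose v N x : R := 1 - \prod_(i < N) (1 - \1_(F i) (phi x)).
have v01 N x : `|v N x| <= 1.
  rewrite /v ger0_norm ?lerBlDr ?lerDl ?subr_ge0.
    by apply: prodr_ge0 => i _; rewrite subr_ge0 indicE lern1 leq_b1.
  by apply: prodr_ile1 => i _; rewrite subr_ge0 lerBlDr lerDl !indicE lern1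
    leq_b1 ler0n.
apply: (trigcl_lim (u_ := v) (C := 1)) => //.
  move=> N; apply: trigclB; first exact: trigcl_cst.
  by apply: trigcl_prod => i; apply: trigclB; [exact: trigcl_cst|exact: cF].
move=> x; apply: cvg_near_cst.
have [[i _ Fi]|nF] := pselect ((\bigcup_k F k) (phi x)).
  exists i.+1 => // N /= iN; rewrite /v indicE mem_set; last by exists i.
  rewrite (bigD1 (Ordinal iN))//= indicE mem_set//= subrr mul0r subr0//.
exists 0 => // N _; rewrite /v indicE memNset// big1 ?subrr// => i _.
by rewrite indicE memNset ?subr0// => Fi; apply: nF; exists i.
Qed.

Definition floorV (x : 'cV[R]_n) : 'cV[int]_n := \col_i Num.floor (x i 0).

(** The representative of [x] modulo Z^n in the cube [0, 1)^n. Composition with it turns any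
    function into a periodic one. *)
Definition fracV (x : 'cV[R]_n) : 'cV[R]_n := x - intcV (floorV x).

Lemma fracV_itv x i : 0 <= fracV x i 0 < 1.
Proof.
by rewrite !mxE subr_ge0 ltrBlDl floor_le/= -[X in _ + X]/(1%:~R)
  -intrD floorD1_gt.
Qed.

Lemma chi_fracV (k : 'cV[int]_n) x : chi k (fracV x) = chi k x.
Proof. by rewrite -[in RHS](subrK (intcV (floorV x)) x) chi_period. Qed.

Lemma sin_2pi_ge0 (y : R) : 0 <= y <= 1 / 2 -> 0 <= sin (2 * pi * y).
Proof.
move=> /andP[y0 y1]; apply: sin_ge0_pi; have := pi_ge0 R => p0.
by apply/andP; split; nra.
Qed.

Lemma sin_2pi_lt0 (y : R) : 1 / 2 < y < 1 -> sin (2 * pi * y) < 0.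
Proof.
move=> /andP[y0 y1]; have p0 := pi_gt0 R.
rewrite (_ : 2 * pi * y = (2 * y - 1) * pi + pi); last by ring.
rewrite sinDpi oppr_lt0; apply: sin_gt0_pi.
by apply/andP; split; nra.
Qed.

Lemma cos_2pi_lt (y z : R) : 0 <= y <= 1 / 2 -> 0 <= z <= 1 / 2 ->
  (cos (2 * pi * y) < cos (2 * pi * z)) = (z < y).
Proof.
move=> /andP[y0 y1] /andP[z0 z1]; have p0 := pi_gt0 R.
have w0 : 0 < 2 * pi :> R by lra.
rewrite ltr_cos ?ltr_pM2l// in_itv/=; apply/andP; split; nra.
Qed.

Lemma cos_2pi_sym (y : R) : cos (2 * pi * (1 - y)) = cos (2 * pi * y).
Proof.
have := cosDint (2 * pi * (- y)) 1; rewrite mulrN cosN => <-.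
by rewrite mulr1 mulrBr mulr1 addrC.
Qed.

(** The position of [y = fracV x i 0] in [0, 1) can be read from the signs of trigonometric
    polynomials: [- sin (2 * pi * y)] is positive exactly on the upper half (1/2, 1), and the cosine
    is monotone on each half. *)
Lemma trigcl_fracV_gt (i : 'I_n) (a : R) :
  trigcl (fun x => (a < fracV x i 0)%R%:R).
Proof.
pose k : 'cV[int]_n := \col_j (j == i)%:R.
have dotE x : dotcV (intcV k) x = x i 0.
  rewrite /dotcV (bigD1 i)//= big1 => [|j ji]; rewrite !mxE ?eqxx ?mul1r
    ?addr0//.
  by rewrite (negbTE ji) mul0r.
have cC : trigcl (fun x => cos (2 * pi * fracV x i 0)).
  apply: trigcl_trig; rewrite (_ : (fun _ => _) =
      fun x => (complex.Re (1 * (chi k x)^*))%:C); first exact/trig_Re/trig_chi.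
  by apply/funext => x; rewrite mul1r Re_conj -chi_fracV /chi/= dotE.
have cS : trigcl (fun x => - sin (2 * pi * fracV x i 0)).
  apply: trigcl_trig; rewrite (_ : (fun _ => _) =
      fun x => (complex.Im (1 * (chi k x)^*))%:C); first exact/trig_Im/trig_chi.
  by apply/funext => x; rewrite mul1r Im_conj -chi_fracV /chi/= dotE.
have cA := trigcl_gt0 (trigclB (trigcl_cst (cos (2 * pi * a))) cC).
have cB := trigcl_gt0 (trigclB cC (trigcl_cst (cos (2 * pi * a)))).
have {}cS := trigcl_gt0 cS.
have [a0|a0] := ltP a 0.
  have := @trigcl_cst R n 1; congr trigcl; apply/funext => x.
  by have /andP[f0 _] := fracV_itv x i; rewrite (lt_le_trans a0).
have [a1|a1] := leP 1 a.
  have := @trigcl_cst R n 0; congr trigcl; apply/funext => x.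
  by have /andP[_ f1] := fracV_itv x i; rewrite ltNge (le_trans (ltW f1)).
(* For [a] in the lower half, [a < y] holds if [y] is in the upper half or the cosine at [y] is
   below that at [a]; the disjunction of indicators is [S + A - S * A]. *)
have [ah|ah] := leP a (1 / 2).
  have := trigclB (trigclD cS cA) (trigclM cS cA); congr trigcl;
    apply/funext => x.
  have := fracV_itv x i; move: (fracV x i 0) => y /andP[y0 y1].
  rewrite oppr_gt0 subr_gt0; have [yh|yh] := leP y (1 / 2).
    have /sin_2pi_ge0 sy : 0 <= y <= 1 / 2 by rewrite y0.
    by rewrite [sin _ < 0]ltNge sy cos_2pi_lt ?y0 ?a0// add0r mul0r subr0.
  have /sin_2pi_lt0 -> : 1 / 2 < y < 1 by rewrite yh.
  by rewrite mul1r addrK (le_lt_trans ah).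
(* For [a] in the upper half, both conditions must hold: [y] in the upper half, where the cosine
   increases, and its cosine above that of [a]. *)
have := trigclM cS cB; congr trigcl; apply/funext => x.
have := fracV_itv x i; move: (fracV x i 0) => y /andP[y0 y1].
rewrite oppr_gt0 subr_gt0; have [yh|yh] := leP y (1 / 2).
  have /sin_2pi_ge0 sy : 0 <= y <= 1 / 2 by rewrite y0.
  by rewrite [sin _ < 0]ltNge sy mul0r [a < y]ltNge ltW// (le_lt_trans yh).
have /sin_2pi_lt0 -> : 1 / 2 < y < 1 by rewrite yh.
rewrite mul1r -[in LHS]cos_2pi_sym -[X in _ < X]cos_2pi_sym cos_2pi_lt.
- by congr ((_ : bool)%:R); apply/idP/idP; lra.
- by apply/andP; split; lra.
- by apply/andP; split; lra.
Qed.

(** Two passes to generators: from Borel sets of R^n to preimages under a coordinate, then from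
    Borel sets of R to open rays, covered by [trigcl_fracV_gt]. *)
Lemma trigcl_indic (S : set 'cV[R]_n) : measurable S ->
  trigcl (fun x => \1_S (fracV x)).
Proof.
apply: (smallest_sub (sigma_algebra_trigcl fracV)) => A.
rewrite -bigcup_seq/= => -[i _ [B mB <-]] /=.
rewrite setTI; suff : trigcl (fun x => \1_B (fracV x i 0)) by [].
have {mB} : (@ocitv R).-sigma.-measurable B by exact: mB.
rewrite RGenOInfty.measurableE; move: B.
apply: (smallest_sub (sigma_algebra_trigcl (fun x => fracV x i 0)))
  => _ [a ->] /=.
under eq_fun do rewrite indicE.
have := trigcl_fracV_gt i a; congr trigcl; apply/funext => x;
  congr ((_ : bool)%:R).
by apply/idP/idP; rewrite inE/= in_itv/= andbT.
Qed.

(** The sum counts the positive integers up to [z], hence is the integer part of [z], written as a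
    finite sum of indicators. *)
Lemma count_le_real (M : nat) (z : R) : 0 <= z <= M%:R ->
  z - 1 <= \sum_(j < M) (j.+1%:R <= z)%R%:R <= z.
Proof.
move=> /andP[z0 zM].
suff [h1 h2] : (M%:R <= z -> \sum_(j < M) (j.+1%:R <= z)%R%:R = M%:R :> R) /\
    (z < M%:R -> z - 1 <= \sum_(j < M) (j.+1%:R <= z)%R%:R <= z).
  have [/h2//|Mz] := ltP z M%:R; rewrite h1//.
  by apply/andP; split; lra.
elim: M {zM} => [|M [IH1 IH2]].
  by rewrite big_ord0; split=> // zl; apply/andP; split; lra.
have MS : M.+1%:R = M%:R + 1 :> R by rewrite natr1.
rewrite big_ord_recr/=; split=> [Mz|zM].
  by rewrite Mz IH1 ?MS//; move: Mz; rewrite MS; lra.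
rewrite [_ <= z]leNgt zM addr0; have [/IH2//|Mz] := ltP z M%:R.
by rewrite IH1//; apply/andP; split; lra.
Qed.

(** Rounding [G] down to multiples of [1 / (m + 1)] gives a finite combination of indicators of
    level sets, at distance at most [1 / (m + 1)] from [G]. *)
Lemma trigcl_measurable01 (G : 'cV[R]_n -> R) : measurable_fun setT G ->
  (forall x, 0 <= G x <= 1) -> trigcl (fun x => G (fracV x)).
Proof.
move=> mG G01.
pose v m x : R := m.+1%:R^-1 * \sum_(j < m.+1) (j.+1%:R <= m.+1%:R * G (fracV
  x))%R%:R.
have vE m x : G (fracV x) - m.+1%:R^-1 <= v m x <= G (fracV x).
  have M0 : 0 < m.+1%:R :> R by [].
  have /andP[g0 g1] := G01 (fracV x).
  have /count_le_real/andP[h1 h2] :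
      0 <= m.+1%:R * G (fracV x) <= m.+1%:R.
    by rewrite mulr_ge0 ?ler_piMr// ltW.
  rewrite /v [_^-1 * _]mulrC ler_pdivlMr// ler_pdivrMr// [G _ * _]mulrC h2
    andbT.
  by rewrite mulrBl mulVf// mulrC.
apply: (trigcl_lim (u_ := v) (C := 1)) => [m|m x|x].
- apply: trigclZ; apply: trigcl_sum => j.
  have mS : measurable (G @^-1` `[j.+1%:R / m.+1%:R, +oo[).
    by rewrite -[_ @^-1` _]setTI; apply: mG => //; exact: measurable_itv.
  have := trigcl_indic mS; congr trigcl; apply/funext => x.
  rewrite indicE; congr ((_ : bool)%:R); apply/idP/idP;
    rewrite inE/= in_itv/= andbT.
    by rewrite ler_pdivrMr// mulrC.
  by rewrite ler_pdivrMr// mulrC.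
- have /andP[_ h2] := vE m x; have /andP[_ g1] := G01 (fracV x).
  have v0 : 0 <= v m x by rewrite /v mulr_ge0 ?invr_ge0// sumr_ge0.
  by rewrite ger0_norm// (le_trans h2).
- apply: (@squeeze_cvgr _ _ _ _ (fun m => G (fracV x) - m.+1%:R^-1)
    (fun=> G (fracV x))).
  + exact: nearW.
  + rewrite -[X in _ --> X]subr0; apply: cvgB; first exact: cvg_cst.
    exact: cvg_harmonic.
  + exact: cvg_cst.
Qed.

Lemma trigcl_measurable_bounded (G : 'cV[R]_n -> R) : measurable_fun setT G ->
  (forall x, `|G x| <= 1) -> trigcl (fun x => G (fracV x)).
Proof.
move=> mG G1; have := trigclB (trigclZ 2
  (trigcl_measurable01 (G := fun x => 2^-1 * (G x + 1)) _ _)) (trigcl_cst 1).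
move=> H; have : trigcl (fun x => 2 * (2^-1 * (G (fracV x) + 1)) - 1).
  apply: H => [|x]; first by apply: measurable_funM => //;
    exact: measurable_funD.
  by have := G1 x; rewrite ler_norml => /andP[? ?]; apply/andP; split; lra.
by congr trigcl; apply/funext => x; lra.
Qed.

Lemma trigcl_ReIm (G : 'cV[R]_n -> R[i]) : cmeas G ->
  (forall x, Normc.normc (G x) <= 1) ->
  trigcl (fun x => complex.Re (G (fracV x))) /\
  trigcl (fun x => complex.Im (G (fracV x))).
Proof.
move=> [GR GI] G1; split.
  apply: (trigcl_measurable_bounded (G := fun y => complex.Re (G y))) => // x.
  exact: le_trans (ler_Re_normc _) (G1 x).
apply: (trigcl_measurable_bounded (G := fun y => complex.Im (G y))) => // x.
exact: le_trans (ler_Im_normc _) (G1 x).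
Qed.

End fractional_part.

(** * Fourier coefficients and periodic multipliers *)

Section periodic_multiplier.
Context {d} {T : measurableType d} {R : realType} {n : nat}.
Variables (mu : {measure set T -> \bar R}) (L : T -> 'cV[R]_n).
Hypothesis mL : measurable_fun setT L.
Implicit Types (v : T -> R[i]) (u w : 'cV[R]_n -> R).

(** For integrable [v], the Fourier coefficients of the image on the torus, under [L] modulo Z^n, of
    the complex measure with density [v]. *)
Definition fourier v (k : 'cV[int]_n) : R[i] :=
  cint mu (fun t => v t * (chi k (L t))^*).

Lemma cintegrable_cmeas v : cintegrable mu v -> cmeas v.
Proof. by move=> [vR vI]; split; apply/measurable_EFinP;
  [exact: measurable_int vR|exact: measurable_int vI]. Qed.

Lemma cintegrableM v (g : T -> R[i]) (C : R) : cintegrable mu v -> cmeas g ->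
  (forall t, Normc.normc (g t) <= C) -> cintegrable mu (fun t => v t * g t).
Proof.
move=> iv mg gC; have iC := integrableZl_EFin C (normc_integrable iv).
apply: (cintegrable_le _ iC) => [|t]; first exact: cmeasM (cintegrable_cmeas
  iv) mg.
by rewrite Normc.normcM mulrC ler_wpM2r ?normc_ge0.
Qed.

Lemma cmeas_compL (p : 'cV[R]_n -> R[i]) : cmeas p -> cmeas (fun t => p (L t)).
Proof. exact: cmeas_comp. Qed.

Lemma cint_trig v (s : seq 'cV[int]_n) (c : 'cV[int]_n -> R[i]) :
  cintegrable mu v ->
  cint mu (fun t => v t * \sum_(k <- s) c k * (chi k (L t))^*) =
  \sum_(k <- s) c k * fourier v k.
Proof.
move=> iv; have ivc k : cintegrable mu (fun t => v t * (chi k (L t))^*).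
  apply: (@cintegrableM _ _ 1) => //.
    by apply: cmeasJ; apply: cmeas_compL; exact: cmeas_chi.
  by move=> t; rewrite normcJ normc_chi.
rewrite -[RHS](cint_sum s c ivc).2; apply: eq_cint => t.
by rewrite big_distrr/=; apply: eq_bigr => k _; rewrite mulrCA.
Qed.

Section bound.
Variables (v : T -> R[i]) (S : R).
Hypothesis iv : cintegrable mu v.
Hypothesis vS : forall s : seq 'cV[int]_n, uniq s ->
  \sum_(k <- s) Normc.normc (fourier v k) ^+ 2 <= S.

(* Bessel's inequality for the functional [p |-> cint mu (v * (p \o L))],
   linearized by AM-GM: in this form it passes to bounded limits. *)
Let bessel (u w : 'cV[R]_n -> R) :=
  2 * (\int[mu]_t (complex.Re (v t) * u (L t)) -
       \int[mu]_t (complex.Im (v t) * w (L t))) <=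
  S + (\int[@torus R n]_x (u x ^+ 2) + \int[@torus R n]_x (w x ^+ 2)).

Lemma integrable_trigcl_comp (g : T -> R) u :
  mu.-integrable setT (EFin \o g) -> trigcl u ->
  mu.-integrable setT (EFin \o (fun t => g t * u (L t))).
Proof.
move=> gi cu; have [C uC] := trigcl_bounded cu.
have mg : measurable_fun setT g by apply/measurable_EFinP;
  exact: measurable_int gi.
apply: (le_integrable measurableT _ _ (integrableZl_EFin C (integrable_norm
  gi))).
  apply/measurable_EFinP; apply: measurable_funM => //.
  exact: (measurableT_comp (trigcl_measurable cu) mL).
move=> t _ /=; rewrite lee_fin normrM mulrC (le_trans _ (ler_norm _))//.
by rewrite ler_wpM2r.
Qed.

Lemma integrable_torus_sqr u : trigcl u ->
  (@torus R n).-integrable setT (EFin \o (fun x => u x ^+ 2)).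
Proof.
move=> cu; have [C uC] := trigcl_bounded cu.
apply: (@bounded_integrable _ _ _ _ _ (C ^+ 2)) => [|x].
  by apply: measurable_funX; exact: trigcl_measurable.
by rewrite normrX ler_sqr ?nnegrE// (le_trans _ (uC x)).
Qed.

Lemma Re_cint_trigcl u w : trigcl u -> trigcl w ->
  complex.Re (cint mu (fun t => v t * (u (L t) +i* w (L t)))) =
  \int[mu]_t (complex.Re (v t) * u (L t)) -
  \int[mu]_t (complex.Im (v t) * w (L t)).
Proof.
move=> cu cw; rewrite /cint/=; rewrite -RintegralB//.
- by apply: eq_Rintegral => t _; rewrite ReM.
- exact: integrable_trigcl_comp iv.1 cu.
- exact: integrable_trigcl_comp iv.2 cw.
Qed.

Lemma int_torus_sqr u w : trigcl u -> trigcl w ->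
  \int[@torus R n]_x (u x ^+ 2) + \int[@torus R n]_x (w x ^+ 2) =
  \int[@torus R n]_x (Normc.normc (u x +i* w x) ^+ 2).
Proof.
move=> cu cw; rewrite -RintegralD//; try exact: integrable_torus_sqr.
by apply: eq_Rintegral => x _; rewrite normc_sqr.
Qed.

Lemma bessel_trig u w : trig (fun x => (u x)%:C) -> trig (fun x => (w x)%:C) ->
  bessel u w.
Proof.
move=> tu tw; have [s [c [us pE]]] := trigD tu (trigM (trig_cst 'i%C) tw).
have {}pE x : u x +i* w x = \sum_(k <- s) c k * (chi k x)^*.
  by rewrite -pE; apply: complex_eq; rewrite !ReImE/=; ring.
have [cu cw] := (trigcl_trig tu, trigcl_trig tw).
rewrite /bessel -Re_cint_trigcl// int_torus_sqr//.
under eq_Rintegral do rewrite pE.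
rewrite parseval_trig//.
rewrite (eq_cint _ (g := fun t => v t * \sum_(k <- s) c k * (chi k (L t))^*));
  last first.
  by move=> t; rewrite pE.
rewrite cint_trig// (le_trans _ (lerD (vS us) (lexx _)))//.
rewrite (_ : _ + _ = \sum_(k <- s) (Normc.normc (fourier v k) ^+ 2 +
    Normc.normc (c k) ^+ 2)); last by rewrite -big_split.
rewrite (_ : complex.Re _ =
    \sum_(k <- s) complex.Re (c k * fourier v k)); last exact: raddf_sum.
rewrite mulr_sumr ler_sum// => k _; rewrite ReM !normc_sqr.
move: (complex.Re (c k)) (complex.Im (c k)) => a b.
move: (complex.Re (fourier v k)) (complex.Im (fourier v k)) => e f.
(* The two squares add up to the squared modulus of [c k - (fourier v k)^*]. *)
have := sqr_ge0 (a - e); have := sqr_ge0 (b + f); lra.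
Qed.

Lemma cvg_int_L (g : T -> R) (u_ : nat -> 'cV[R]_n -> R) u C :
  mu.-integrable setT (EFin \o g) -> (forall m, trigcl (u_ m)) ->
  (forall m x, `|u_ m x| <= C) -> (forall x, u_ ^~ x @ \oo --> u x) ->
  (fun m => \int[mu]_t (g t * u_ m (L t))) @ \oo --> \int[mu]_t (g t * u (L t)).
Proof.
move=> gi cu uC ucv.
apply: (cvg_Rintegral_bounded (f_ := fun m t => u_ m (L t)) gi) => //.
by move=> m; exact: (measurableT_comp (trigcl_measurable (cu m)) mL).
Qed.

Lemma cvg_int_torus (u_ : nat -> 'cV[R]_n -> R)
  u C : (forall m, trigcl (u_ m)) ->
  (forall m x, `|u_ m x| <= C) -> (forall x, u_ ^~ x @ \oo --> u x) ->
  (fun m => \int[@torus R n]_x (u_ m x ^+ 2)) @ \oo --> \int[@torus R n]_x (u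
    x ^+ 2).
Proof.
move=> cu uC ucv.
have i1 : (@torus R n).-integrable setT (EFin \o (fun=> 1 : R)).
  by apply: (@bounded_integrable _ _ _ _ _ 1) => // x; rewrite normr1.
have := cvg_Rintegral_bounded (f_ := fun m x => u_ m x ^+ 2)
  (f := fun x => u x ^+ 2) (C := C ^+ 2) i1.
under eq_fun do under eq_Rintegral do rewrite mul1r.
under [X in _ --> X]eq_Rintegral do rewrite mul1r.
apply=> [m|m x|x].
- by apply: measurable_funX; exact: trigcl_measurable.
- by rewrite normrX ler_sqr ?nnegrE// (le_trans _ (uC m x)).
- exact: (cvgM (ucv x) (ucv x)).
Qed.

(** Both sides are continuous along bounded pointwise limits, by dominated convergence, in [u] and
    in [w] separately; two nested inductions descend to polynomials. *)
Lemma bessel_trigcl u w : trigcl u -> trigcl w -> bessel u w.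
Proof.
move=> cu cw; have cst (a : R) : (fun _ : nat => a)
  @ \oo --> a by exact: cvg_cst.
elim: cw => {w} [w tw|w_ w C cw IH wC wcv].
  elim: cu => {u} [u tu|u_ u C cu IH uC ucv]; first exact: bessel_trig.
  have l1 := cvgM (cst 2)
    (cvgB (cvg_int_L iv.1 cu uC ucv) (cst (\int[mu]_t (complex.Im (v t)
      * w (L t))))).
  have l2 := cvgD (cst S) (cvgD (cvg_int_torus cu uC ucv)
    (cst (\int[@torus R n]_x (w x ^+ 2)))).
  by apply: (@ler_cvg_to nat \oo _ R _ _ _ _ (l1 _ _) (l2 _ _)); exact: nearW.
have l1 := cvgM (cst 2)
  (cvgB (cst (\int[mu]_t (complex.Re (v t) * u (L t))))
    (cvg_int_L iv.2 cw wC wcv)).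
have l2 := cvgD (cst S) (cvgD (cst (\int[@torus R n]_x (u x ^+ 2)))
  (cvg_int_torus cw wC wcv)).
by apply: (@ler_cvg_to nat \oo _ R _ _ _ _ (l1 _ _) (l2 _ _)); exact: nearW.
Qed.

Lemma fourier_mul_le (G : 'cV[R]_n -> R[i]) (s : seq 'cV[int]_n) :
  cmeas G -> (forall x, Normc.normc (G x) <= 1) -> uniq s ->
  \sum_(k <- s) Normc.normc (fourier (fun t => v t * G (fracV (L t))) k)
    ^+ 2 <= S.
Proof.
move=> mG G1 us; set v' : T -> R[i] := fun t => v t * G (fracV (L t)).
(* With conjugated coefficients, the integral of [v'] against [q] and the squared torus norm of [q]
   both equal the sum to be bounded. *)
pose c k := (fourier v' k)^*; pose q x := \sum_(k <- s) c k * (chi k x)^*.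
have tq : trig q by exists s, c.
pose q1 x := complex.Re (q x); pose q2 x := complex.Im (q x).
have cq1 : trigcl q1 by apply: trigcl_trig; exact: trig_Re.
have cq2 : trigcl q2 by apply: trigcl_trig; exact: trig_Im.
have [cG1 cG2] := trigcl_ReIm mG G1.
pose f x := G (fracV x) * q x.
have cf1 : trigcl (fun x => complex.Re (f x)).
  by under eq_fun do rewrite ReM; apply: trigclB; apply: trigclM.
have cf2 : trigcl (fun x => complex.Im (f x)).
  by under eq_fun do rewrite ImM; apply: trigclD; apply: trigclM.
have iv' : cintegrable mu v'.
  apply: (cintegrableM (g := fun t => G (fracV (L t))) (C := 1)) => //.
  split; first exact: (measurableT_comp (trigcl_measurable cG1) mL).
  exact: (measurableT_comp (trigcl_measurable cG2) mL).
have := bessel_trigcl cf1 cf2.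
rewrite /bessel -(Re_cint_trigcl cf1 cf2) (int_torus_sqr cf1 cf2).
rewrite (eq_cint _ (g := fun t => v' t * q (L t))); last first.
  by move=> t; rewrite /v' -mulrA; congr (_ * _); apply: complex_eq.
rewrite cint_trig// (_ : complex.Re _ = \sum_(k <- s)
  Normc.normc (fourier v' k) ^+ 2).
  (* As [G] has modulus at most 1, [f] is dominated by [q], whose norm Parseval computes. *)
  have le1 : \int[@torus R n]_x (Normc.normc (complex.Re (f x)
    +i* complex.Im (f x)) ^+ 2)
      <= \sum_(k <- s) Normc.normc (fourier v' k) ^+ 2.
    under [leRHS]eq_bigr do rewrite -normcJ.
    rewrite -(parseval_trig c us); apply: le_Rintegral => //.
    - have := integrableD measurableT (integrable_torus_sqr cf1)
        (integrable_torus_sqr cf2).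
      by apply: eq_integrable => // x _; rewrite [RHS]/comp normc_sqr.
    - have := integrableD measurableT (integrable_torus_sqr cq1)
        (integrable_torus_sqr cq2).
      by apply: eq_integrable => // x _; rewrite [RHS]/comp normc_sqr.
    - move=> x _; rewrite (_ : _ +i* _ = f x); last exact: complex_eq.
      rewrite /f Normc.normcM exprMn ler_piMl ?sqr_ge0//.
      by rewrite expr_le1// normc_ge0.
  lra.
rewrite raddf_sum; apply: eq_bigr => k _.
by rewrite -Re_mulJ mulrC.
Qed.

End bound.
End periodic_multiplier.

(** * Gabor coefficients *)

Section gabor.
Context {R : realType} {d : nat}.
Local Notation mu := (@lebesgue_cV R d).
Implicit Types (A B : 'M[R]_d) (f g v w m h : 'cV[R]_d -> R[i]).

Lemma cLnorm2E f :
  cLnorm 2%:E f = poweR (\int[mu]_x (Normc.normc (f x) ^+ 2)%:E) 2^-1.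
Proof.
rewrite /cLnorm unlock; congr poweR; apply: eq_integral => x _ /=.
by rewrite ger0_norm ?normc_ge0// powR_mulrn ?normc_ge0.
Qed.

Lemma measurable_normc_sqr f : cmeasurable f ->
  measurable_fun setT (fun x => (Normc.normc (f x) ^+ 2)%:E).
Proof.
move=> mf; apply/measurable_EFinP; apply: measurable_funX;
  exact: measurable_normc.
Qed.

Lemma cLnorm2_ae_eq f g : cmeasurable f -> cmeasurable g ->
  {ae mu, forall x, Normc.normc (f x) = Normc.normc (g x)} ->
  cLnorm 2%:E f = cLnorm 2%:E g.
Proof.
move=> mf mg fg; rewrite !cLnorm2E; congr poweR.
apply: ge0_ae_eq_integral => //; try exact: measurable_normc_sqr.
1,2: by move=> x _; rewrite lee_fin sqr_ge0.
by apply: filterS fg => x /= ->.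
Qed.

Lemma cLp2_integrable f : cLp 2%:E f ->
  mu.-integrable setT (EFin \o (fun x => Normc.normc (f x) ^+ 2)).
Proof.
move=> [mf]; rewrite cLnorm2E => /lty_poweRy -/(_ _)fy.
apply/integrableP; split; first exact: measurable_normc_sqr.
under eq_integral do rewrite /= ger0_norm ?sqr_ge0//.
by apply: fy; rewrite invr_eq0 pnatr_eq0.
Qed.

Lemma cLp2_translate g (c : 'cV[R]_d) : cLp 2%:E g ->
  cLp 2%:E (fun x => g (x + c)).
Proof.
move=> [mg gy]; split; first exact: cmeas_comp (measurable_translate_cV c) mg.
move: gy; rewrite !cLnorm2E => gy.
rewrite (ge0_integral_translate_cV c (f := fun x => (Normc.normc (g x)
  ^+ 2)%:E))//.
  exact: measurable_normc_sqr.
by move=> x; rewrite lee_fin sqr_ge0.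
Qed.

Lemma cLp2_mul_integrable f g : cLp 2%:E f -> cLp 2%:E g ->
  cintegrable mu (fun t => f t * (g t)^*).
Proof.
move=> Lf Lg; apply: (cintegrable_le (g := fun t =>
    Normc.normc (f t) ^+ 2 + Normc.normc (g t) ^+ 2)).
- by apply: cmeasM; [exact: Lf.1|apply: cmeasJ; exact: Lg.1].
- exact: (integrableD measurableT (cLp2_integrable Lf) (cLp2_integrable Lg)).
- move=> t; rewrite Normc.normcM normcJ.
  have := normc_ge0 (f t); have := normc_ge0 (g t).
  by move: (Normc.normc (f t)) (Normc.normc (g t)) => a b ? ?; nra.
Qed.

Lemma ae_lattice (P : 'cV[int]_d -> 'cV[R]_d -> Prop) :
  (forall k, {ae mu, forall x, P k x}) -> {ae mu, forall x, forall k, P k x}.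
Proof.
move=> aeP; have := @ae_foralln _ _ _ mu
  (* The lattice is countable: its points are enumerated by their codes, and a natural number coding
     no point imposes no condition. *)
  (fun n x => if unpickle n is Some k then P k x else True) _.
move=> H; have : {ae mu, forall x, forall n : nat,
    if (unpickle n : option 'cV[int]_d) is Some k then P k x else True}.
  by apply: H => n; case: (unpickle n) => [k|]; [exact: aeP|exact: aeW].
by apply: filterS => x Px k; have := Px (pickle k); rewrite pickleK.
Qed.

(** A transfer of real bounds on finite sums is what [fourier_mul_le] supplies. It suffices here,
    since an infinite right-hand side leaves nothing to prove. *)
Lemma esum_le_uniq (a b : 'cV[int]_d -> R) : (forall k, 0 <= a k) ->
  (forall k, 0 <= b k) ->
  (forall S, (forall s, uniq s -> \sum_(k <- s) b k <= S) ->
     forall s, uniq s -> \sum_(k <- s) a k <= S) ->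
  (\esum_(k in setT) (a k)%:E <= \esum_(k in setT) (b k)%:E)%E.
Proof.
move=> a0 b0 ab.
have bge0 : (0 <= \esum_(k in setT) (b k)%:E)%E.
  by apply: esum_ge0 => k _; rewrite lee_fin.
case E : (\esum_(k in setT) (b k)%:E)%E => [S| |]; last 2 first.
- by rewrite leey.
- by rewrite E in bge0.
apply: ge_ereal_sup => _ [X [finX _] <-].
rewrite fsbig_finite//= sumEFin lee_fin; apply: ab => [s us|].
  rewrite -lee_fin -sumEFin -E; apply: esum_ge; exists [set` s].
    by split=> //; exact: finite_seq.
  by rewrite -fsbig_seq.
exact: finmap.fset_uniq.
Qed.

Lemma cmeas_fracV (G : 'cV[R]_d -> R[i]) : cmeas G ->
  (forall x, Normc.normc (G x) <= 1) -> cmeas (fun x => G (fracV x)).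
Proof.
by move=> mG G1; have [? ?] := trigcl_ReIm mG G1; split;
  exact: trigcl_measurable.
Qed.

Section periodic.
Variable B : 'M[R]_d.
Hypothesis uB : B \in unitmx.
Local Notation L := (fun t : 'cV[R]_d => B^T *m t).
Local Notation coef v k := (fourier mu L v k).

Lemma esum_fourier_le v w m : cintegrable mu v -> cmeas w -> cmeas m ->
  {ae mu, forall t, w t = v t * m t} ->
  {ae mu, forall t, Normc.normc (m t) = 1} ->
  (forall k, {ae mu, forall t, m (t - invmx B^T *m intcV k) = m t}) ->
  (\esum_(k in [set: 'cV[int]_d]) (Normc.normc (coef w k) ^+ 2)%:E <=
   \esum_(k in [set: 'cV[int]_d]) (Normc.normc (coef v k) ^+ 2)%:E)%E.
Proof.
move=> iv mw mm wE m1 mper.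
have mL : measurable_fun setT L by exact: measurable_mulmx_cV.
(* The modulus of [m] is controlled only almost everywhere; the truncation [M] is bounded by 1 at
   every point and agrees with [m] almost everywhere. *)
pose M t : R[i] := if Normc.normc (m t) <= 1 then m t else 0.
pose G s := M (invmx B^T *m s).
have mM : cmeas M.
  have mb : measurable_fun setT (fun t => Normc.normc (m t) <= 1).
    by apply: measurable_fun_ler => //; exact: measurable_normc.
  split; rewrite /M.
    under eq_fun do rewrite (fun_if (@complex.Re R)).
    by apply: measurable_fun_ifT => //; exact: mm.1.
  under eq_fun do rewrite (fun_if (@complex.Im R)).
  by apply: measurable_fun_ifT => //; exact: mm.2.
have mG : cmeas G by exact: (cmeas_comp (measurable_mulmx_cV _) mM).
have G1 x : Normc.normc (G x) <= 1.
  by rewrite /G /M; case: ifP => //; rewrite Normc.normc0.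
have coefE k : coef w k = coef (fun t => v t * G (fracV (L t))) k.
  have mchi : cmeas (fun t => (chi k (L t))^*).
    by apply: cmeasJ; apply: (cmeas_comp mL); exact: cmeas_chi.
  apply: cint_ae_eq.
  - exact: cmeasM.
  - apply: cmeasM => //; apply: cmeasM; first exact: cintegrable_cmeas iv.
    exact: (cmeas_comp mL (cmeas_fracV mG G1)).
  (* Passing to [fracV (L t)] shifts [t] by the dual lattice point of index [floorV (L t)]. This
     index varies with [t], so one null set must serve all shifts. *)
  have aem := ae_lattice mper.
  apply: filterS2 wE (filterI m1 aem) => t /= -> [mt1 mper_t];
    congr (_ * _ * _).
  rewrite /G /fracV mulmxBr mulKmx ?unitmx_tr// /M mper_t mt1 lexx.
  by [].
apply: esum_le_uniq => [k|k|S vS s us]; try exact: sqr_ge0.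
under eq_bigr do rewrite coefE.
exact: (fourier_mul_le mL iv vS mG G1 us).
Qed.

(** Transposing [B] in the phase turns the modulation at frequency [B k] into the character [chi k]
    evaluated at [B^T t]. *)
Lemma inner_gabor A f g (l k : 'cV[int]_d) :
  inner f (gabor_atom A B g l k) =
  coef (fun t => f t * (g (t - A *m intcV l))^*) k.
Proof.
rewrite /inner -[LHS]/(cint mu _); apply: eq_cint => t.
rewrite /gabor_atom rmorphM/= dotcV_mulmx /chi.
by rewrite [X in _ * X]mulrC mulrA.
Qed.

End periodic.
End gabor.

(** * Periodicity of the unimodular ratio and conclusion *)

Lemma normc1_mulJ (R : realType) (z : R[i]) : Normc.normc z = 1 -> z * z^* = 1.
Proof.
move=> z1; apply: complex_eq; first by rewrite Re_mulJ z1 expr1n.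
by rewrite !ReImE /=; ring.
Qed.

(** Exchanges the two shifts in the hypothesis on [h]. With [x], [y], [z], [u] the values of [h] at
    [t], [t - b], [t - a], [t - a - b], the conclusion is the invariance under [b] of
    [h * (h (. - a))^*]. *)
Lemma unimodular_ratio (R : realType) (x y z u : R[i]) :
  z * z^* = 1 -> y * y^* = 1 -> x * y^* = z * u^* -> y * u^* = x * z^*.
Proof.
move=> zz yy e; rewrite -[LHS]mulr1 -zz.
transitivity (y * z^* * (z * u^*)); first by ring.
rewrite -e; transitivity (x * z^* * (y * y^*)); first by ring.
by rewrite yy mulr1.
Qed.

Lemma esum_pair (R : realType) (I J : choiceType) (a : I -> J -> \bar R) :
  (forall i j, 0 <= a i j)%E ->
  (\esum_(ij in [set: I * J]) a ij.1 ij.2 =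
   \esum_(i in [set: I]) \esum_(j in [set: J]) a i j)%E.
Proof.
move=> a0; rewrite esum_esum//; congr esum.
by apply/seteqP; split.
Qed.

Unset Implicit Arguments.
Local Open Scope complex_scope.

Theorem theorem1p3 (R : realType) (d : nat) (A B : 'M[R]_d)
    (h : 'cV[R]_d -> R[i]) :
  (1 <= d)%N ->
  A \in unitmx -> B \in unitmx ->
  `|\det (A *m B)| <= 1 ->
  cLp +oo%E h ->
  {ae lebesgue_cV d, forall x, `|h x| = 1} ->
  (forall l k : 'cV[int]_d, k != 0 ->
    {ae lebesgue_cV d, forall x,
      h x * (h (x - invmx B^T *m intcV k))^* =
      h (x - A *m intcV l) *
        (h (x - A *m intcV l - invmx B^T *m intcV k))^*}) ->
  functional_gabor_multiplier A B h.
Proof.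
move=> _ _ uB _ Lh h1c hper; split=> // g [Lg Pg].
have {h1c} h1 : {ae lebesgue_cV d, forall x, Normc.normc (h x) = 1}.
  (* The norm in [R[i]] is itself a complex number, with real part [Normc.normc]. *)
  by apply: filterS h1c => x /(congr1 (@complex.Re R)).
have mh := Lh.1.
have Lhg : cLp 2%:E (fun x => h x * g x).
  have mhg : cmeasurable (fun x => h x * g x) := cmeasM mh Lg.1.
  split=> //; rewrite (cLnorm2_ae_eq mhg Lg.1) ?Lg.2//.
  by apply: filterS h1 => x hx; rewrite Normc.normcM hx mul1r.
split=> // f Lf.
(* Since [h] is unimodular, [f'] has the norm of [f]; it is the function to which the Parseval
   identity of [g] is applied. *)
pose f' x := f x * (h x)^*.
have mf' : cmeasurable f' := cmeasM Lf.1 (cmeasJ mh).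
have f'f : cLnorm 2%:E f' = cLnorm 2%:E f.
  apply: cLnorm2_ae_eq mf' Lf.1 _.
  by apply: filterS h1 => x hx; rewrite Normc.normcM normcJ hx mulr1.
have Lf' : cLp 2%:E f' by split=> //; rewrite f'f; exact: Lf.2.
rewrite -f'f -(Pg f' Lf').
rewrite (esum_pair (a := fun l k =>
  (Normc.normc (inner f (gabor_atom A B (fun x => h x * g x) l k)) ^+ 2)%:E));
    last first.
  by move=> l k; rewrite lee_fin sqr_ge0.
rewrite (esum_pair (a := fun l k =>
  (Normc.normc (inner f' (gabor_atom A B g l k)) ^+ 2)%:E)); last first.
  by move=> l k; rewrite lee_fin sqr_ge0.
(* The two double sums agree already for each fixed translation [l]. *)
apply: eq_esum => l _.
under eq_esum do rewrite inner_gabor.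
under [RHS]eq_esum do rewrite inner_gabor.
set w := fun t => f t * _; set v := fun t => f' t * _.
pose a := A *m intcV l.
pose m t := h t * (h (t - a))^*.
have iv : cintegrable (lebesgue_cV d) v.
  exact: cLp2_mul_integrable Lf' (cLp2_translate (- a) Lg).
have iw : cintegrable (lebesgue_cV d) w.
  exact: cLp2_mul_integrable Lf (cLp2_translate (- a) Lhg).
have mm : cmeas m.
  by apply: cmeasM => //; apply: cmeasJ; exact: cmeas_comp
    (measurable_translate_cV (- a)) mh.
have h1a := ae_translate_cV (- a) h1.
have m1 : {ae lebesgue_cV d, forall t, Normc.normc (m t) = 1}.
  by apply: filterS2 h1 h1a => t ht hta; rewrite Normc.normcM normcJ ht hta
    mulr1.
have mper k : {ae lebesgue_cV d, forall t, m (t - invmx B^T *m intcV k) = m t}.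
  (* The hypothesis on [h] speaks of nonzero [k] only; for [k = 0] there is no shift. *)
  have [->|k0] := eqVneq k 0.
    by apply: aeW => t; rewrite /intcV map_mx0 mulmx0 subr0.
  have h1k := ae_translate_cV (- (invmx B^T *m intcV k)) h1.
  apply: filterS2 (filterI h1a h1k) (hper l k k0) => t /= [hta htk].
  rewrite /m -/a (addrAC t) => e.
  exact: unimodular_ratio (normc1_mulJ hta) (normc1_mulJ htk) e.
(* Almost everywhere [w = v * m] and, [m] being unimodular, [v = w * m^*]. The conjugate is again
   unimodular and periodic, so the same inequality applies in both directions. *)
apply/eqP; rewrite eq_le; apply/andP; split.
  apply: (esum_fourier_le uB iv (cintegrable_cmeas iw) mm _ m1 mper).
  apply: filterS h1 => t /normc1_mulJ ht.
  rewrite /w /v /f' /m -/a rmorphM/=.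
  transitivity (f t * (h (t - a))^* * (g (t - a))^* * (h t * (h t)^*)).
    by rewrite ht mulr1 mulrA.
  by ring.
apply: (esum_fourier_le uB iw (cintegrable_cmeas iv) (cmeasJ mm)).
- apply: filterS h1a => t /normc1_mulJ hta.
  rewrite /w /v /f' /m -/a !rmorphM/= conjCK.
  transitivity (f t * (h t)^* * (g (t - a))^* * (h (t - a) * (h (t - a))^*)).
    by rewrite hta mulr1.
  by ring.
- by apply: filterS m1 => t mt; rewrite normcJ.
- by move=> k; apply: filterS (mper k) => t ->.
Qed.
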